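(* For all $p,q\in\mathbb{N}$ with $n:=p+q\ge 2$, the Clifford algebra $\mathbb{R}_{p,q}$ endowed with the Clifford conjugation satisfies $$\mathcal{N}(\mathbb{R}_{p,q})\le\frac{n^3+5n+6}{6},$$ where $\mathcal{N}(\mathbb{R}_{p,q})$ is the Nash number.
   Context: **Clifford algebras.** $\mathbb{N}$ includes $0$. For $n=p+q$, $\mathbb{R}_{p,q}$ is the associative real algebra of dimension $2^n$ with basis $\{e_K\}_{K\in\mathcal{P}(n)}$ ($\mathcal{P}(n)$ is the power set of $\{1,\dots,n\}$), where $e_\varnothing=1$, $e_K=e_{k_1}\cdots e_{k_s}$ for $K=\{k_1<\dots<k_s\}$ (with $e_k:=e_{\{k\}}$), $e_k^2=1$ for $1\le k\le p$, $e_k^2=-1$ for $p+1\le k\le n$, and $e_ke_h=-e_he_k$ for $k\ne h$. The Clifford conjugation is the real linear involution $x\mapsto x^c$ with $e_K^c=e_K$ if $|K|\equiv 0,3\bmod 4$ and $e_K^c=-e_K$ if $|K|\equiv 1,2\bmod 4$. Let $A=\mathbb{R}_{p,q}$ with this involution, and $\mathbb{S}_A:=\{J\in A:J^c=-J,\ J^2=-1\}$. **Slice regular functions.** For $J\in\mathbb{S}_A$ let $\mathbb{C}_J:=\{\alpha+\beta J:\alpha,\beta\in\mathbb{R}\}$, and let $Q_A:=\bigcup_{J\in\mathbb{S}_A}\mathbb{C}_J$. For $D\subset\mathbb{C}$ non-empty, open and invariant under complex conjugation, let $\Omega_D:=\{\alpha+\beta J:\alpha,\beta\in\mathbb{R},\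 \alpha+i\beta\in D,\ J\in\mathbb{S}_A\}\subset Q_A$ (an open circular set). A stem function on $D$ is $F=F_1+\iota F_2:D\to A\otimes_{\mathbb{R}}\mathbb{C}$ ($\iota$ the imaginary unit of the second factor, $F_1,F_2:D\to A$) with $F_1(\bar z)=F_1(z)$, $F_2(\bar z)=-F_2(z)$. It induces the slice function $f=\mathcal{I}(F):\Omega_D\to A$, $f(\alpha+\beta J)=F_1(\alpha+i\beta)+JF_2(\alpha+i\beta)$; $F$ is uniquely determined by $f$. $f$ is slice regular if $F$ is of class $C^1$ and $\frac{\partial F}{\partial\alpha}+\iota\frac{\partial F}{\partial\beta}=0$. The real components of $f$ are the functions $f_K:\Omega_D\to\mathbb{R}$ with $f=\sum_K f_Ke_K$. **Nash functions.** Let $k=\mathbb{R}$ or $\mathbb{C}$ and $U\subset k^m$ open. $h:U\to k$ is a $k$-Nash function (real Nash, resp. complex Nash) on $U$ if every point of $U$ has an open neighbourhood $V\subset U$ on which $h$ is $k$-analytic and a non-zero polynomial $P\in k[x_1,\dots,x_m,t]$ with $P(x,h(x))=0$ for all $x\in V$. Identify $A$ with $\mathbb{R}^{\dim A}$ through the basis $\{e_K\}$; a function $g:\Omega\to\mathbb{R}$ on an open circular set $\Omega\subset Q_A$ is a real Nash function on $\Omega$ if every point of $\Omega$ has an open neighbourhood $V$ in $A$ and a real Nash function on $V$ which coincides with $g$ on $V\cap\Omega$. **Slice-Nash functions.** Let $J\in\mathbb{S}_A$; left multiplication makes $A$ a $\mathbb{C}_J$-vector space, of dimension $u_A+1=\dim(A)/2$.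 If $\{J_0=1,J_1,\dots,J_{u_A}\}$ is a $\mathbb{C}_J$-basis of $A$, the real basis $\{1,J,J_1,JJ_1,\dots,J_{u_A},JJ_{u_A}\}$ is called a splitting basis of $A$ associated to $J$. Given a stem function $F=F_1+\iota F_2$ on $D$, write uniquely $F_s=\sum_{k=0}^{u_A}(F_{s,1}^{J,J_k}+F_{s,2}^{J,J_k}J)J_k$ ($s=1,2$) with $F_{s,\ell}^{J,J_k}:D\to\mathbb{R}$, and set $F^{\ell}_{J,J_k}:=F_{1,\ell}^{J,J_k}+iF_{2,\ell}^{J,J_k}:D\to\mathbb{C}$. $F$ is a stem-Nash function on $D$ if there exist $J\in\mathbb{S}_A$ and a splitting basis associated to $J$ such that $F^{\ell}_{J,J_k}$ is a complex Nash function on $D$ for all $\ell\in\{1,2\}$, $k\in\{0,\dots,u_A\}$. $f=\mathcal{I}(F)$ is a slice-Nash function on $\Omega_D$ if $F$ is stem-Nash on $D$. **Nash number.** $\mathcal{N}(A)$ is the minimum integer $\ell$ for which there is a subset $\mathcal{K}\subset\mathcal{P}(n)$ of cardinality $\ell$ such that, for each open circular set $\Omega\subset Q_A$ and each slice regular $f:\Omega\to A$, if $f_K$ is a real Nash function on $\Omega$ for each $K\in\mathcal{K}$, then $f$ is a slice-Nash function. *)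

(* Defs.v *)
From HB Require Import structures.
From mathcomp Require Import all_boot all_order all_algebra.
From mathcomp Require Import complex.
From mathcomp Require Import all_classical all_reals all_analysis.
From mathcomp.analysis.showcase Require Import summability.
From mathcomp Require Import (canonicals, coercions) mpoly.

Set Implicit Arguments.
Unset Strict Implicit.
Unset Printing Implicit Defensive.

Import Order.TTheory GRing.Theory Num.Theory.
Import numFieldNormedType.Exports.

Local Open Scope classical_set_scope.
Local Open Scope ring_scope.
Local Open Scope complex_scope.

(* An element is the family of its coordinates in the basis (e_K); the
   generators e_1, ..., e_n are indexed from 0, by 'I_(p + q). *)
Definition clifford (R : comNzRingType) (p q : nat) : Type :=
  {ffun {set 'I_(p + q)} -> R^o}.

HB.instance Definition _ (R : comNzRingType) (p q : nat) :=
  GRing.Lmodule.copy (clifford R p q) {ffun {set 'I_(p + q)} -> R^o}.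

Section CliffordAlgebra.
Variables (R : comNzRingType) (p q : nat).
Notation A := (clifford R p q).
Notation index := {set 'I_(p + q)}.
Implicit Types (x y z : A) (H K L M : index) (i j : 'I_(p + q)).

Definition cl_coef x K : R := (x : {ffun index -> R^o}) K.

Definition cl_basis K : A := [ffun L => (L == K)%:R].

Definition symdiff H K : index := (H :\: K) :|: (K :\: H).

(* the sign picked up by the pair of generators e_i, e_j when the word
   e_H e_K is sorted: e_j has to jump over e_i if j < i, and e_i e_i = +-1 *)
Definition gen_sign i j : R :=
  if (i < j)%N then 1 else if (j < i)%N then -1 else
  if (i < p)%N then 1 else -1.

Definition cl_sign H K : R := \prod_(i in H) \prod_(j in K) gen_sign i j.

Definition cl_mul x y : A :=
  \sum_H \sum_K (cl_coef x H * cl_coef y K * cl_sign H K)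
    *: cl_basis (symdiff H K).

Definition cl_one : A := cl_basis finset.set0.

Lemma gen_signM i j : gen_sign i j * gen_sign i j = 1.
Proof. by rewrite /gen_sign; do !case: ifP => _; rewrite ?mulrNN mulr1. Qed.

Lemma in_symdiff H K i : (i \in symdiff H K) = (i \in H) (+) (i \in K).
Proof. by rewrite !inE; case: (i \in H); case: (i \in K). Qed.

Lemma symdiffA H K L : symdiff H (symdiff K L) = symdiff (symdiff H K) L.
Proof. by apply/setP => i; rewrite !in_symdiff addbA. Qed.

Lemma prod_symdiff (g : 'I_(p + q) -> R) H K : (forall i, g i * g i = 1) ->
  \prod_(i in symdiff H K) g i = (\prod_(i in H) g i) * (\prod_(i in K) g i).
Proof.
move=> gg; rewrite big_mkcond [X in X * _]big_mkcond [X in _ * X]big_mkcond.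
rewrite -big_split; apply: eq_bigr => i _ /=; rewrite in_symdiff.
by case: (i \in H); case: (i \in K) => /=; rewrite ?mulr1 ?mul1r ?gg.
Qed.

Lemma cl_signDl H K L : cl_sign (symdiff H K) L = cl_sign H L * cl_sign K L.
Proof.
apply: prod_symdiff => i; rewrite -big_split big1 // => j _.
exact: gen_signM.
Qed.

Lemma cl_signDr H K L : cl_sign H (symdiff K L) = cl_sign H K * cl_sign H L.
Proof.
rewrite /cl_sign -big_split; apply: eq_bigr => i _ /=.
by apply: prod_symdiff => j; exact: gen_signM.
Qed.

Lemma cl_coefE x : x = \sum_K cl_coef x K *: cl_basis K.
Proof.
apply/ffunP => L; rewrite sum_ffunE (bigD1 L) //= !ffunE eqxx big1 ?addr0.
  by rewrite [RHS]mulr1.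
by move=> K KL; rewrite !ffunE eq_sym (negbTE KL) [LHS]mulr0.
Qed.

Lemma cl_coefD x y K : cl_coef (x + y) K = cl_coef x K + cl_coef y K.
Proof. exact: ffunE. Qed.

Lemma cl_coefZ (a : R) x K : cl_coef (a *: x) K = a * cl_coef x K.
Proof. exact: ffunE. Qed.

Lemma cl_coef_basis H K : cl_coef (cl_basis H) K = (K == H)%:R.
Proof. exact: ffunE. Qed.

Lemma cl_mulDl : left_distributive cl_mul +%R.
Proof.
move=> x y z; rewrite -big_split; apply: eq_bigr => H _ /=.
rewrite -big_split; apply: eq_bigr => K _ /=.
by rewrite cl_coefD !mulrDl scalerDl.
Qed.

Lemma cl_mulDr : right_distributive cl_mul +%R.
Proof.
move=> x y z; rewrite -big_split; apply: eq_bigr => H _ /=.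
rewrite -big_split; apply: eq_bigr => K _ /=.
by rewrite cl_coefD mulrDr mulrDl scalerDl.
Qed.

Lemma cl_mulZl (a : R) x y : cl_mul (a *: x) y = a *: cl_mul x y.
Proof.
rewrite scaler_sumr; apply: eq_bigr => H _; rewrite scaler_sumr.
by apply: eq_bigr => K _; rewrite cl_coefZ scalerA !mulrA.
Qed.

Lemma cl_mulZr (a : R) x y : cl_mul x (a *: y) = a *: cl_mul x y.
Proof.
rewrite scaler_sumr; apply: eq_bigr => H _; rewrite scaler_sumr.
by apply: eq_bigr => K _; rewrite cl_coefZ scalerA mulrCA !mulrA.
Qed.

Lemma cl_mul_basis H K :
  cl_mul (cl_basis H) (cl_basis K) = cl_sign H K *: cl_basis (symdiff H K).
Proof.
rewrite /cl_mul (bigD1 H) //= [X in _ + X]big1 ?addr0.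
  rewrite (bigD1 K) //= big1 ?addr0 ?cl_coef_basis ?eqxx ?mul1r //.
  by move=> L LK; rewrite !cl_coef_basis (negbTE LK) mulr0 mul0r scale0r.
move=> L LH; apply: big1 => M _.
by rewrite !cl_coef_basis (negbTE LH) !mul0r scale0r.
Qed.

Lemma cl_mul_suml (I : finType) (F : I -> A) y :
  cl_mul (\sum_i F i) y = \sum_i cl_mul (F i) y.
Proof.
apply: (big_morph (cl_mul^~ y)) => [u v|]; first exact: cl_mulDl.
by have := cl_mulZl 0 0 y; rewrite !scale0r.
Qed.

Lemma cl_mul_sumr (I : finType) (F : I -> A) x :
  cl_mul x (\sum_i F i) = \sum_i cl_mul x (F i).
Proof.
apply: (big_morph (cl_mul x)) => [u v|]; first exact: cl_mulDr.
by have := cl_mulZr 0 x 0; rewrite !scale0r.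
Qed.

Lemma cl_mulA : associative cl_mul.
Proof.
have assoc H K L : cl_mul (cl_basis H) (cl_mul (cl_basis K) (cl_basis L)) =
    cl_mul (cl_mul (cl_basis H) (cl_basis K)) (cl_basis L).
  rewrite !cl_mul_basis cl_mulZl cl_mulZr !cl_mul_basis !scalerA symdiffA.
  by rewrite cl_signDl cl_signDr mulrC -mulrA.
have suml := cl_mul_suml; have sumr := cl_mul_sumr.
have Zl := cl_mulZl; have Zr := cl_mulZr.
move: cl_mul assoc suml sumr Zl Zr => f assoc suml sumr Zl Zr x y z.
rewrite (cl_coefE x) !suml; apply: eq_bigr => H _; rewrite !Zl; congr (_ *: _).
rewrite (cl_coefE y) !(suml, sumr); apply: eq_bigr => K _.
rewrite !(Zl, Zr); congr (_ *: _).
rewrite (cl_coefE z) !sumr; apply: eq_bigr => L _.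
by rewrite !Zr assoc.
Qed.

Lemma cl_mul1x : left_id cl_one cl_mul.
Proof.
move=> x; rewrite [in RHS](cl_coefE x) [in LHS](cl_coefE x) cl_mul_sumr.
apply: eq_bigr => K _; rewrite cl_mulZr cl_mul_basis /cl_sign big_set0 scale1r.
by congr (_ *: cl_basis _); apply/setP => i; rewrite in_symdiff inE.
Qed.

Lemma cl_mulx1 : right_id cl_one cl_mul.
Proof.
move=> x; rewrite [in RHS](cl_coefE x) [in LHS](cl_coefE x) cl_mul_suml.
apply: eq_bigr => K _; rewrite cl_mulZl cl_mul_basis /cl_sign.
rewrite big1 => [|i _]; last exact: big_set0.
rewrite scale1r.
by congr (_ *: cl_basis _); apply/setP => i; rewrite in_symdiff inE addbF.
Qed.

Lemma cl_oner_neq0 : cl_one != 0.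
Proof.
apply/eqP => /ffunP /(_ finset.set0); rewrite !ffunE eqxx => /eqP.
by rewrite oner_eq0.
Qed.

HB.instance Definition _ := GRing.Zmodule_isNzRing.Build A
  cl_mulA cl_mul1x cl_mulx1 cl_mulDl cl_mulDr cl_oner_neq0.

Lemma cl_scalerAl (a : R) x y : a *: (x * y) = (a *: x) * y.
Proof. exact/esym/cl_mulZl. Qed.

Lemma cl_scalerAr (a : R) x y : a *: (x * y) = x * (a *: y).
Proof. exact/esym/cl_mulZr. Qed.

HB.instance Definition _ := GRing.Lmodule_isLalgebra.Build R A cl_scalerAl.
HB.instance Definition _ := GRing.Lalgebra_isAlgebra.Build R A cl_scalerAr.

Definition cl_gen i : A := cl_basis [set i]%SET.

Lemma cl_basis0 : cl_basis finset.set0 = 1.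
Proof. by []. Qed.

Lemma cl_gen_sqr i : cl_gen i * cl_gen i = if (i < p)%N then 1 else -1.
Proof.
rewrite [LHS]cl_mul_basis /cl_sign !big_set1 /gen_sign ltnn.
have -> : symdiff [set i]%SET [set i]%SET = finset.set0.
  by apply/setP => j; rewrite in_symdiff addbb inE.
by case: ifP; rewrite cl_basis0 ?scale1r ?scaleN1r.
Qed.

Lemma cl_gen_anticomm i j : i != j -> cl_gen i * cl_gen j = - (cl_gen j * cl_gen i).
Proof.
move=> ij; rewrite [cl_gen i * _]cl_mul_basis [cl_gen j * _]cl_mul_basis.
have -> : symdiff [set j]%SET [set i]%SET = symdiff [set i]%SET [set j]%SET.
  by apply/setP => k; rewrite !in_symdiff addbC.
rewrite /cl_sign !big_set1 -scaleNr /gen_sign; congr (_ *: _).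
by case: ltngtP => [||/val_inj/eqP]; rewrite ?opprK ?(negbTE ij).
Qed.

Lemma cl_basis_prod K : cl_basis K = \prod_(i <- enum K) cl_gen i.
Proof.
have : sorted ltn [seq val i | i <- enum K].
  apply: (subseq_sorted ltn_trans (s2 := [seq val i | i <- enum 'I_(p + q)])).
    rewrite {1}/enum_mem -enumT; exact/map_subseq/filter_subseq.
  by rewrite val_enum_ord iota_ltn_sorted.
have -> : cl_basis K = cl_basis [set i in enum K]%SET.
  by congr cl_basis; apply/setP => i; rewrite inE mem_enum.
elim: (enum K) => [_|i s IHs /=].
  by rewrite big_nil -cl_basis0; congr cl_basis; apply/setP => i; rewrite !inE.
rewrite path_sortedE; last exact: ltn_trans.
case/andP => /allP lt_i srt; rewrite big_cons -IHs //.
have ilt j : j \in s -> (i < j)%N by move=> js; apply/lt_i/map_f.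
rewrite [RHS]cl_mul_basis /cl_sign big_set1 big1 ?scale1r => [|j]; last first.
  by rewrite inE /gen_sign => /ilt ->.
congr cl_basis; apply/setP => j; rewrite in_symdiff !inE.
by case: eqVneq => //= ->; case: (boolP (i \in s)) => // /ilt; rewrite ltnn.
Qed.

Definition cl_conj x : A :=
  [ffun K : index => if (#|K| %% 4 == 0)%N || (#|K| %% 4 == 3)%N
                     then cl_coef x K else - cl_coef x K].

End CliffordAlgebra.

Section Nash.
Variables (k : numFieldType) (m : nat).
Implicit Types (U V : set 'rV[k]_m) (h : 'rV[k]_m -> k) (a x : 'rV[k]_m).

(* h is, on a polydisc around a, the sum of a power series in m variables; the
   sum over the multi-indices is unconditional: limit along the directed set of
   finite sets of multi-indices *)
Definition analytic_at h a : Prop :=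
  exists (c : {ffun 'I_m -> nat} -> k) (r : k), 0 < r /\
    forall x, (forall i, `|x 0 i| < r) ->
      partial_sum (fun al : {ffun 'I_m -> nat} => c al * \prod_i x 0 i ^+ al i)
        @ totally --> h (a + x).

(* the point (x, t) of k^(m+1) *)
Definition graph_point x (t : k) (i : 'I_m.+1) : k :=
  if unlift ord_max i is Some j then x 0 j else t.

Definition nash_on U h : Prop :=
  forall a, U a -> exists V,
    [/\ open V, V a, V `<=` U,
        (forall x, V x -> analytic_at h x)
      & exists2 P : mpoly.mpoly m.+1 k, P != 0
          & forall x, V x -> mpoly.meval (graph_point x (h x)) P = 0].

End Nash.

Section Slice.
Variables (R : realType) (p q : nat).

(* the ascription gives access to the topology of C = R[i] *)
Local Notation C := (R[i] : numFieldType).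
Local Notation A := (clifford R p q).
Local Notation index := {set 'I_(p + q)}.

Implicit Types (D : set C) (J : A) (f : A -> A) (F : C -> A * A).

Definition sphere : set A := [set J | cl_conj J = - J /\ J * J = -1].

Definition complex_line J : set A :=
  [set x | exists a b : R, x = a%:A + b *: J].

Definition circular D : set A :=
  [set x | exists (a b : R) J,
     [/\ D (a +i* b), sphere J & x = a%:A + b *: J]].

Definition circular_base D : Prop :=
  [/\ D !=set0, open D & forall z, D z -> D (conjc z)].

(* A (x)_R C is represented as A * A, the pair (x, y) standing for x + iota y;
   functions on D or on Omega_D are restrictions of total functions. *)
Definition stem D F : Prop :=
  forall z, D z -> (F (conjc z)).1 = (F z).1 /\ (F (conjc z)).2 = - (F z).2.

Definition induces D F f : Prop :=
  forall (a b : R) J, D (a +i* b) -> sphere J ->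
    f (a%:A + b *: J) = (F (a +i* b)).1 + J * (F (a +i* b)).2.

Definition iota_mul (w : A * A) : A * A := (- w.2, w.1).

Definition line_alpha (g : C -> R) (z : C) (t : R) : R := g (z + (t +i* 0)).
Definition line_beta (g : C -> R) (z : C) (t : R) : R := g (z + (0 +i* t)).

Definition d_alpha (g : C -> R) (z : C) : R := derive1 (line_alpha g z) 0.
Definition d_beta (g : C -> R) (z : C) : R := derive1 (line_beta g z) 0.

Definition C1_on D (g : C -> R) : Prop :=
  forall z, D z ->
    [/\ derivable (line_alpha g z) 0 1, derivable (line_beta g z) 0 1,
        {for z, continuous (d_alpha g)} & {for z, continuous (d_beta g)}].

Definition stem_C1_on D F : Prop :=
  forall K : index, C1_on D (fun z => cl_coef (F z).1 K) /\
                    C1_on D (fun z => cl_coef (F z).2 K).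

Definition stem_partial (d : (C -> R) -> C -> R) F (z : C) : A * A :=
  ([ffun K : index => d (fun w => cl_coef (F w).1 K) z],
   [ffun K : index => d (fun w => cl_coef (F w).2 K) z]).

Definition holomorphic_on D F : Prop :=
  stem_C1_on D F /\
  forall z, D z ->
    stem_partial d_alpha F z + iota_mul (stem_partial d_beta F z) = 0.

Definition slice_regular D f : Prop :=
  exists F, [/\ stem D F, induces D F f & holomorphic_on D F].

(* the identification of A with R^(dim A) through the basis (e_K) *)
Definition coords (x : A) : 'rV[R]_#|{: index}| :=
  \row_i cl_coef x (enum_val i).

Definition real_nash_on (Omega : set A) (g : A -> R) : Prop :=
  forall x, Omega x ->
    exists (V : set 'rV[R]_#|{: index}|) (G : 'rV[R]_#|{: index}| -> R),
      [/\ open V, V (coords x), nash_on V G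
        & forall y, Omega y -> V (coords y) -> g y = G (coords y)].

Definition complex_nash_on D (g : C -> C) : Prop :=
  nash_on [set x : 'rV[C]_1 | D (x 0 0)] (fun x => g (x 0 0)).

(* u_A + 1 = dim A / 2 = 2 ^ (n - 1) *)
Definition uA : nat := (2 ^ (p + q).-1).-1.

Definition splitting_basis J (B : 'I_uA.+1 -> A) : Prop :=
  [/\ B ord0 = 1,
      (forall c : 'I_uA.+1 -> A, (forall k, complex_line J (c k)) ->
         \sum_k c k * B k = 0 -> forall k, c k = 0)
    & (forall x : A, exists2 c : 'I_uA.+1 -> A,
         forall k, complex_line J (c k) & x = \sum_k c k * B k)].

(* the G s l k are the components F_{s,l}^{J,J_k} of the stem function, with
   s, l in {1, 2} encoded as booleans (false for 1, true for 2) *)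
Definition splitting_components D F J (B : 'I_uA.+1 -> A)
    (G : bool -> bool -> 'I_uA.+1 -> C -> R) : Prop :=
  forall z, D z ->
    (F z).1 = \sum_k ((G false false k z)%:A + G false true k z *: J) * B k /\
    (F z).2 = \sum_k ((G true false k z)%:A + G true true k z *: J) * B k.

Definition stem_nash D F : Prop :=
  exists J B G,
    [/\ sphere J, splitting_basis J B, splitting_components D F J B G
      & forall l k,
          complex_nash_on D (fun z => G false l k z +i* G true l k z)].

Definition slice_nash D f : Prop :=
  exists F, [/\ stem D F, induces D F f & stem_nash D F].

Definition nash_determining (KK : {set index}) : Prop :=
  forall D f, circular_base D -> slice_regular D f ->
    (forall K, K \in KK -> real_nash_on (circular D) (fun x => cl_coef (f x) K)) ->
    slice_nash D f.

Definition is_nash_number (l : nat) : Prop :=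
  (exists2 KK : {set index}, #|KK| = l & nash_determining KK) /\
  (forall KK : {set index}, nash_determining KK -> (l <= #|KK|)%N).

Lemma is_nash_number_uniq l l' :
  is_nash_number l -> is_nash_number l' -> l = l'.
Proof.
move=> [[K <- dK] minK] [[K' <- dK'] minK'].
by apply/eqP; rewrite eqn_leq minK // minK'.
Qed.

End Slice.

(* Main.v *)
Require Import Defs.
From mathcomp Require Import all_boot all_order all_algebra.
From mathcomp Require Import complex polyXY zify ring lra.
From mathcomp Require Import all_classical all_reals all_analysis.
From mathcomp Require Import perm finmap.
From mathcomp.analysis.showcase Require Import summability.
From mathcomp Require Import (canonicals, coercions) mpoly.
Set Implicit Arguments.
Unset Strict Implicit.
Unset Printing Implicit Defensive.
Import Order.TTheory GRing.Theory Num.Theory.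
Import numFieldNormedType.Exports.
Local Open Scope classical_set_scope.
Local Open Scope ring_scope.
Local Open Scope complex_scope.
Local Notation Re := complex.Re.
Local Notation Im := complex.Im.

(** Let F = F1 + iota F2 be the stem function of f, and write phi_K for the
    complex-valued function F1_K + i F2_K made of the components of index K. The
    functions phi_K are holomorphic, and in a suitable splitting basis they are,
    up to signs, the functions that have to be complex Nash. Holomorphy on a disc
    gives power series through the Cauchy formula (hol_taylor, hol_analytic), so
    it remains to prove that every phi_L is algebraic.

    One component of f controls many of them. Call M good if e_M is an
    imaginary unit, that is if it belongs to the sphere of A. Multiplication by
    e_M only permutes the coordinates up to signs (cl_coef_mul_basis). So on the
    plane of e_M, and on that of - e_M, the function f_K is the real part of
    phi_K - i s phi_L, and of phi_K + i s phi_L, where L is the symmetric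
    difference of M and K and s is a sign. If f_K is real Nash, these real parts
    satisfy polynomial relations with the real coordinates of the plane
    (slice_polynomial). A holomorphic function with such a real part is algebraic
    (algebraic_of_real_part): the relation extends to complex values of the two
    coordinates by the identity theorem, and then z and its conjugate can be
    treated as independent variables, the second being fixed. By difference phi_L
    is algebraic (component_algebraic).

    Thus a family of indices K is determining as soon as each L is the symmetric
    difference of some K in the family and of some good M. Whether M is good
    depends on the size of M modulo 4 and on the parity of its number of positive
    indices. Both can be corrected by changing M at three well chosen indices
    only (good_modification), so the 8 subsets of these three indices form such
    a family; when n is too small to choose the three indices, all the subsets
    do (good_cover). In every case their number is at most the bound. *)

(** * Continuity and derivatives over a field with a norm *)

Section Derivative.
Variable K : numFieldType.
Implicit Types (z w : K) (f g : K -> K).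

Section Continuity.
Variables (T : topologicalType) (x : T).
Implicit Types h k : T -> K.

Lemma continuous_cstC (a : K) : {for x, continuous (fun=> a : K)}.
Proof. exact: (@cst_continuous T K). Qed.

Lemma continuousDC h k : {for x, continuous h} -> {for x, continuous k} ->
  {for x, continuous (fun y => h y + k y : K)}.
Proof. by move=> ch ck; exact: (@cvgD K K T (nbhs x) _ h k (h x) (k x)). Qed.

Lemma continuousMC h k : {for x, continuous h} -> {for x, continuous k} ->
  {for x, continuous (fun y => h y * k y : K)}.
Proof. by move=> ch ck; exact: (@cvgM K T (nbhs x) _ h k (h x) (k x)). Qed.

Lemma continuousVC h : {for x, continuous h} -> h x != 0 ->
  {for x, continuous (fun y => (h y)^-1 : K)}.
Proof. by move=> ch h0; exact: (@cvgV K T (nbhs x) _ h (h x)). Qed.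

Lemma continuous_sumK (I : Type) (r : seq I) (H : I -> T -> K) :
  (forall i, {for x, continuous (H i)}) ->
  {for x, continuous (fun y => \sum_(i <- r) H i y : K)}.
Proof.
move=> cH; elim: r => [|i r IH].
  have -> : (fun y => \sum_(i <- [::]) H i y) = (fun=> 0).
    by apply/funext => y; rewrite big_nil.
  exact: continuous_cstC.
have -> : (fun y => \sum_(j <- i :: r) H j y) = (fun y => H i y + \sum_(j <- r) H j y).
  by apply/funext => y; rewrite big_cons.
by apply: continuousDC; [exact: cH|exact: IH].
Qed.

Lemma continuous_prodK (I : Type) (r : seq I) (H : I -> T -> K) :
  (forall i, {for x, continuous (H i)}) ->
  {for x, continuous (fun y => \prod_(i <- r) H i y : K)}.
Proof.
move=> cH; elim: r => [|i r IH].
  have -> : (fun y => \prod_(i <- [::]) H i y) = (fun=> 1).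
    by apply/funext => y; rewrite big_nil.
  exact: continuous_cstC.
have -> : (fun y => \prod_(j <- i :: r) H j y) = (fun y => H i y * \prod_(j <- r) H j y).
  by apply/funext => y; rewrite big_cons.
by apply: continuousMC; [exact: cH|exact: IH].
Qed.

Lemma continuousXK (h : T -> K) n : {for x, continuous h} ->
  {for x, continuous (fun y => h y ^+ n : K)}.
Proof.
move=> ch; elim: n => [|n IH].
  have -> : (fun y => h y ^+ 0) = (fun=> 1) by apply/funext => y; rewrite expr0.
  exact: continuous_cstC.
have -> : (fun y => h y ^+ n.+1) = (fun y => h y * h y ^+ n).
  by apply/funext => y; rewrite exprS.
exact: continuousMC.
Qed.

End Continuity.

Lemma continuous_idC z : {for (z : K), continuous (fun w : K => w)}.
Proof. exact: (@cvg_id K). Qed.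

Lemma continuous_comp_for (T U V : topologicalType) (x : T) (g : T -> U) (h : U -> V) :
  {for x, continuous g} -> {for g x, continuous h} ->
  {for x, continuous (fun y => h (g y))}.
Proof. exact: continuous_comp. Qed.

Lemma continuous_affine (a b z : K) : {for z, continuous (fun w : K => a * w + b : K)}.
Proof.
apply: continuousDC; last exact: continuous_cstC.
by apply: continuousMC; [exact: continuous_cstC|exact: continuous_idC].
Qed.

(** The difference quotient is required to extend continuously
    (Caratheodory): the product and chain rules become identities between the
    extended quotients, without division. *)
Definition cder f z d := exists q : K -> K,
  [/\ forall w, f w - f z = q w * (w - z), {for z, continuous q} & q z = d].

Lemma cder_continuous f z d : cder f z d -> {for z, continuous f}.
Proof.
move=> [q [fq cq _]].
have -> : f = fun w => q w * (w - z) + f z.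
  by apply/funext => w; rewrite -fq subrK.
apply: continuousDC; last exact: continuous_cstC.
apply: continuousMC; first exact: cq.
by apply: continuousDC; [exact: continuous_idC|exact: continuous_cstC].
Qed.

Lemma cder_cst (a : K) z : cder (fun=> a) z 0.
Proof.
exists (fun=> 0); split; [|exact: continuous_cstC|by []].
by move=> w; rewrite subrr mul0r.
Qed.

Lemma cderD f g z df dg : cder f z df -> cder g z dg ->
  cder (fun w => f w + g w) z (df + dg).
Proof.
move=> [q [fq cq <-]] [r [gr cr <-]]; exists (fun w => q w + r w); split; [| |by []].
  by move=> w; rewrite mulrDl -fq -gr opprD addrACA.
by apply: continuousDC; [exact: cq|exact: cr].
Qed.

Lemma cderM f g z df dg : cder f z df -> cder g z dg ->
  cder (fun w => f w * g w) z (df * g z + f z * dg).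
Proof.
move=> hf [r [gr cr <-]]; have cf := cder_continuous hf.
move: hf => [q [fq cq <-]].
exists (fun w => q w * g z + f w * r w); split; [| |by []].
  by move=> w; rewrite mulrDl mulrAC -fq -mulrA -gr; ring.
apply: continuousDC.
  by apply: continuousMC; [exact: cq|exact: continuous_cstC].
by apply: continuousMC; [exact: cf|exact: cr].
Qed.

Lemma cder_id z : cder (fun w => w) z 1.
Proof.
exists (fun=> 1); split; [|exact: continuous_cstC|by []].
by move=> w; rewrite mul1r.
Qed.

Lemma cderX n z : cder (fun w => w ^+ n) z (n%:R * z ^+ n.-1).
Proof.
elim: n => [|n IH]; first by rewrite mul0r; exact: cder_cst.
have -> : (fun w : K => w ^+ n.+1) = (fun w => w * w ^+ n).
  by apply/funext => w; rewrite exprS.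
have := cderM (cder_id z) IH; congr (cder _ _ _).
case: n {IH} => [|n /=]; first by rewrite !mul0r mulr0 addr0 mulr1.
by rewrite mul1r mulrCA -exprS -{1}[z ^+ n.+1]mul1r -mulrDl -[1]/(1%:R) -natrD.
Qed.

Lemma cder_affine f (a b : K) z d : cder f (a * z + b) d ->
  cder (fun w => f (a * w + b)) z (d * a).
Proof.
move=> [q [fq cq <-]]; exists (fun w => q (a * w + b) * a); split; [| |by []].
  by move=> w; rewrite fq; ring.
apply: continuousMC; last exact: continuous_cstC.
by apply: (continuous_comp_for (g := fun w : K => a * w + b)); [exact: continuous_affine|exact: cq].
Qed.

End Derivative.

(** * The topology of the complex numbers and the derivatives of paths *)

Section ComplexTopology.
Variable R : realType.
Local Notation C := (R[i] : numFieldType).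
(** The modulus as a real number: the norm of R[i] takes its values in R[i],
    where inequalities carry the side condition of being real. *)
Definition nc (z : R[i]) : R := Normc.normc z.
Implicit Types (z w : R[i]) (f g : C -> C).

Lemma normC_nc z : `|z : C| = (nc z)%:C.
Proof. by case: z. Qed.

Lemma nc_ge0 z : 0 <= nc z.
Proof. by case: z => a b; exact: sqrtr_ge0. Qed.

Lemma nc0 : nc 0 = 0.
Proof. exact: Normc.normc0. Qed.

Lemma nc1 : nc 1 = 1.
Proof. exact: Normc.normc1. Qed.

Lemma ncM z w : nc (z * w) = nc z * nc w.
Proof. exact: Normc.normcM. Qed.

Lemma ncD z w : nc (z + w) <= nc z + nc w.
Proof. exact: (@le_normcD R z w). Qed.

Lemma ncN z : nc (- z) = nc z.
Proof. exact: (@normcN R z). Qed.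

Lemma ncC z w : nc (z - w) = nc (w - z).
Proof. by rewrite -ncN opprB. Qed.

Lemma ncB z w : nc (z - w) <= nc z + nc w.
Proof. by rewrite -[leRHS](congr1 (fun x => nc z + x) (ncN w)) ncD. Qed.

Lemma ncX z n : nc (z ^+ n) = nc z ^+ n.
Proof. by elim: n => [|n IH]; [exact: Normc.normc1|rewrite !exprS ncM IH]. Qed.

Lemma ncV z : nc z^-1 = (nc z)^-1.
Proof. exact: Normc.normcV. Qed.

Lemma nc_real (a : R) : nc a%:C = `|a|.
Proof. by rewrite /Normc.normc /= expr0n /= addr0 sqrtr_sqr. Qed.

Lemma ncJ z : nc (conjc z) = nc z.
Proof. by case: z => a b /=; rewrite sqrrN. Qed.

Lemma nc_eq0 z : (nc z == 0) = (z == 0).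
Proof. by apply/eqP/eqP => [/Normc.eq0_normc //|->]; exact: nc0. Qed.

Lemma nc_gt0 z : (0 < nc z) = (z != 0).
Proof. by rewrite lt_def nc_eq0 nc_ge0 andbT. Qed.

Lemma ncRe z : `|Re z| <= nc z.
Proof. by have := normc_ge_Re z; rewrite normC_nc lecR. Qed.

Lemma ncIm z : `|Im z| <= nc z.
Proof.
case: z => a b /=; rewrite -sqrtr_sqr ler_wsqrtr //.
by rewrite lerDr sqr_ge0.
Qed.

Lemma nc_le z : nc z <= `|Re z| + `|Im z|.
Proof.
rewrite [z in leLHS]complexE; apply: le_trans (ncD _ _) _.
rewrite ncM !nc_real lerD2l /= expr0n expr1n /= add0r sqrtr1 mul1r //.
Qed.

Lemma nc_sum (I : Type) (r : seq I) (P : pred I) (F : I -> R[i]) :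
  nc (\sum_(i <- r | P i) F i) <= \sum_(i <- r | P i) nc (F i).
Proof.
elim/big_ind2: _ => [|x1 x2 y1 y2 h1 h2|//]; first by rewrite nc0.
by apply: le_trans (ncD _ _) _; exact: lerD.
Qed.

Lemma Cpos (e : C) : 0 < e -> exists2 d : R, 0 < d & e = d%:C.
Proof.
case: e => a b; rewrite ltcE /= => /andP[/eqP -> a0].
by exists a.
Qed.

Section Cvg.
Variables (T : Type) (F : set_system T) (FF : Filter F).

Lemma cvgCP (f : T -> C) (l : C) :
  f @ F --> l <-> forall e : R, 0 < e -> \forall x \near F, nc (f x - l) < e.
Proof.
split=> [/cvgrPdist_lt h e e0|h].
  have e0' : 0 < (e%:C : C) by rewrite ltcE /= eqxx.
  near do rewrite ncC -ltcR -normC_nc.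
  exact: h.
apply/cvgrPdist_lt => e /Cpos[d d0 ->].
near do rewrite distrC normC_nc ltcR.
exact: h.
Unshelve. all: by end_near. Qed.

Lemma cvg_Re (f : T -> C) (l : C) : f @ F --> l -> (fun x => Re (f x)) @ F --> Re l.
Proof.
move=> /cvgCP h; apply/cvgrPdist_lt => e /h; apply: filterS => x.
by rewrite distrC -raddfB; apply: le_lt_trans (ncRe _).
Qed.

Lemma cvg_Im (f : T -> C) (l : C) : f @ F --> l -> (fun x => Im (f x)) @ F --> Im l.
Proof.
move=> /cvgCP h; apply/cvgrPdist_lt => e /h; apply: filterS => x.
by rewrite distrC -raddfB; apply: le_lt_trans (ncIm _).
Qed.

Lemma cvg_complex (f : T -> C) (l : C) :
  (fun x => Re (f x)) @ F --> Re l -> (fun x => Im (f x)) @ F --> Im l ->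
  f @ F --> l.
Proof.
move=> /cvgrPdist_lt hr /cvgrPdist_lt hi; apply/cvgCP => e e0.
have e20 : 0 < e / 2 by rewrite divr_gt0.
move: (hi _ e20) (hr _ e20); apply: filterS2 => x xi xr.
apply: le_lt_trans (nc_le _) _; rewrite !raddfB [ltRHS]splitr.
by rewrite ltrD // distrC.
Qed.

Lemma cvg_conjc (f : T -> C) (l : C) :
  f @ F --> l -> (fun x => conjc (f x) : C) @ F --> (conjc l : C).
Proof.
move=> /cvgCP h; apply/cvgCP => e /h; apply: filterS => x.
by rewrite -rmorphB ncJ.
Qed.

End Cvg.

Lemma cvg_realC (T : Type) (F : set_system T) (FF : Filter F) (f : T -> R) (l : R) :
  f @ F --> l -> (fun x => (f x)%:C : C) @ F --> (l%:C : C).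
Proof.
move=> /cvgrPdist_lt h; apply/cvgCP => e /h; apply: filterS => x.
by rewrite -rmorphB nc_real distrC.
Qed.

Lemma nbhsCP z (P : set C) :
  nbhs (z : C) P <-> exists2 e : R, 0 < e & forall w, nc (w - z) < e -> P w.
Proof.
split=> [/nbhs_ballP[e /Cpos[d d0 ->] h]|[e e0 h]].
  exists d => // w wz; apply: h.
  by rewrite -ball_normE /= distrC normC_nc ltcR.
apply/nbhs_ballP; exists e%:C => /=; first by rewrite ltcR.
by move=> w; rewrite -ball_normE /= distrC normC_nc ltcR => /h.
Qed.

Section ContinuousParts.
Variables (T : topologicalType) (x : T).
Implicit Types h : T -> C.

Lemma continuousCP h : {for x, continuous h} <->
  forall e : R, 0 < e -> \forall y \near x, nc (h y - h x) < e.
Proof. exact: (@cvgCP T (nbhs x) _ h (h x)). Qed.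

Lemma continuous_ReP h : {for x, continuous h} -> {for x, continuous (fun y => Re (h y))}.
Proof. exact: (@cvg_Re T (nbhs x) _ h (h x)). Qed.

Lemma continuous_ImP h : {for x, continuous h} -> {for x, continuous (fun y => Im (h y))}.
Proof. exact: (@cvg_Im T (nbhs x) _ h (h x)). Qed.

Lemma continuous_parts h : {for x, continuous (fun y => Re (h y))} ->
  {for x, continuous (fun y => Im (h y))} -> {for x, continuous h}.
Proof. exact: (@cvg_complex T (nbhs x) _ h (h x)). Qed.

Lemma continuous_conj h : {for x, continuous h} ->
  {for x, continuous (fun y => conjc (h y) : C)}.
Proof. exact: (@cvg_conjc T (nbhs x) _ h (h x)). Qed.

Lemma continuous_real (u : T -> R) : {for x, continuous u} ->
  {for x, continuous (fun y => (u y)%:C : C)}.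
Proof. exact: (@cvg_realC T (nbhs x) _ u (u x)). Qed.

End ContinuousParts.

Lemma cder_conj f z d : cder f (conjc z) d ->
  cder (fun w => conjc (f (conjc w))) z (conjc d).
Proof.
move=> [q [fq cq <-]]; exists (fun w => conjc (q (conjc w))); split; [| |by []].
  move=> w; apply: (can_inj (@conjcK R)).
  by rewrite rmorphB rmorphM rmorphB /= !conjcK fq.
apply: continuous_conj.
apply: (@continuous_comp_for C C C z (fun w : C => conjc w : C) q); last exact: cq.
by apply: (@continuous_conj C); exact: (@continuous_idC C).
Qed.

(** Paths are differentiated in the real sense, so that the fundamental theorem of
    calculus and the mean value theorem apply to each part. *)
Definition rder (g : R -> C) (t : R) (d : C) :=
  is_derive t 1 (fun s => Re (g s)) (Re d) /\
  is_derive t 1 (fun s => Im (g s)) (Im d).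

(** The same extended quotients as for the complex derivative: composing a path
    with a complex differentiable function is then again a product of
    quotients. *)
Lemma rderP (g : R -> C) t d : rder g t d <-> exists q : R -> C,
  [/\ forall s, g s - g t = q s * (s - t)%:C, {for t, continuous q} & q t = d].
Proof.
split=> [[/is_derive1_caratheodory[a [ga ca at_]]
          /is_derive1_caratheodory[b [gb cb bt]]]|[q [gq cq <-]]].
  exists (fun s => a s +i* b s); split.
  - move=> s; apply/eqP; rewrite eq_complex !raddfB ga gb /=.
    by rewrite !(subrr, mulr0) subr0 add0r !eqxx.
  - exact: continuous_parts.
  - by rewrite at_ bt; case: (d).
split; apply/is_derive1_caratheodory.
  exists (fun s => Re (q s)); split; [|exact: continuous_ReP|by []] => s.
  by rewrite -raddfB gq; case: (q s) => u v /=; rewrite ?subrr mulr0 subr0.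
exists (fun s => Im (q s)); split; [|exact: continuous_ImP|by []] => s.
by rewrite -raddfB gq; case: (q s) => u v /=; rewrite ?subrr mulr0 add0r.
Qed.

Lemma rder_continuous (g : R -> C) t d : rder g t d -> {for t, continuous g}.
Proof.
move=> /rderP[q [fq cq _]].
have -> : g = fun s => q s * (s - t)%:C + g t.
  by apply/funext => w; rewrite -fq subrK.
apply: (@continuousDC C); last exact: continuous_cstC.
apply: (@continuousMC C); [exact: cq|apply: continuous_real].
by apply: cvgB; [exact: cvg_id|exact: cvg_cst].
Qed.

Lemma rder_comp f (g : R -> C) t d e : cder f (g t) d -> rder g t e ->
  rder (fun s => f (g s)) t (d * e).
Proof.
move=> [q [fq cq <-]] hg; have cg := rder_continuous hg.
move: hg => /rderP[r [gr cr <-]]; apply/rderP.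
exists (fun s => q (g s) * r s); split; [| |by []].
  by move=> s; rewrite fq gr mulrA.
apply: (@continuousMC C); last exact: cr.
exact: (@continuous_comp_for R C C _ _ _ cg cq).
Qed.

Lemma rderMc (g : R -> C) t d (c : C) : rder g t d -> rder (fun s => g s * c) t (d * c).
Proof.
move=> /rderP[r [gr cr <-]]; apply/rderP; exists (fun s => r s * c); split; [| |by []].
  by move=> s; rewrite -mulrBl gr mulrAC.
by apply: (@continuousMC C); [exact: cr|exact: (@continuous_cstC C)].
Qed.

Lemma rder_affine (a b : C) (t : R) : rder (fun s => a + s%:C * b) t b.
Proof.
apply/rderP; exists (fun=> b); split; [|exact: (@continuous_cstC C)|by []].
by move=> s; rewrite rmorphB /=; ring.
Qed.

Lemma rderMcD (g : R -> C) t d (a c : C) : rder g t d -> rder (fun s => a + c * g s) t (c * d).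
Proof.
move=> /rderP[r [gr cr <-]]; apply/rderP; exists (fun s => c * r s); split; [| |by []].
  by move=> s; rewrite -mulrA -gr; ring.
by apply: (@continuousMC C); [exact: (@continuous_cstC C)|exact: cr].
Qed.

End ComplexTopology.

(** * Complex integrals over a period *)

Section CircleIntegral.
Variable R : realType.
Local Notation C := (R[i] : numFieldType).
Local Notation mu := (@lebesgue_measure R).
Local Notation I2pi := `[0%R, (pi *+ 2 : R)]%classic.

Definition rint (g : R -> R) : R := \int[mu]_(x in I2pi) g x.

Lemma pi2_gt0 : 0 < pi *+ 2 :> R.
Proof. by rewrite pmulrn_lgt0 // pi_gt0. Qed.

Lemma integrable_cont (g : R -> R) : continuous g ->
  mu.-integrable I2pi (EFin \o g).
Proof.
move=> cg; apply: continuous_compact_integrable; first exact: segment_compact.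
exact: continuous_subspaceT.
Qed.

Lemma rintD (g h : R -> R) : continuous g -> continuous h ->
  rint (fun x => g x + h x) = rint g + rint h.
Proof. by move=> cg ch; rewrite /rint RintegralD //; exact: integrable_cont. Qed.

Lemma rintZ (a : R) (g : R -> R) : continuous g -> rint (fun x => a * g x) = a * rint g.
Proof. by move=> cg; rewrite /rint RintegralZl //; exact: integrable_cont. Qed.

Lemma measure_I2pi : fine (mu I2pi) = pi *+ 2.
Proof.
have := @lebesgue_measure_itv R `[0, pi *+ 2] => /=.
by rewrite lte_fin pi2_gt0 => -> /=; rewrite subr0.
Qed.

Lemma rint_le (g : R -> R) (B : R) : continuous g -> (forall x, `|g x| <= B) ->
  `|rint g| <= B * (pi *+ 2).
Proof.
move=> cg gB; apply: le_trans.
  by apply: le_normr_Rintegral => //; exact: integrable_cont.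
have -> : B * (pi *+ 2) = \int[mu]_(_ in I2pi) B.
  by rewrite Rintegral_cst ?measure_I2pi //; exact: measurable_itv.
apply: le_Rintegral; [exact: measurable_itv| | |by []].
- apply: integrable_cont => x.
  by apply: continuous_comp; [exact: cg|exact: norm_continuous].
- by apply: integrable_cont; exact: cst_continuous.
Qed.

Lemma rint_FTC (F g : R -> R) : (forall x : R, is_derive x 1 F (g x)) -> continuous g ->
  rint g = F (pi *+ 2) - F 0.
Proof.
move=> dF cg.
have cF : continuous F.
  by move=> x; apply/differentiable_continuous/derivable1_diffP; case: (dF x).
rewrite /rint /Rintegral (@continuous_FTC2 R g F) ?pi2_gt0 //.
- exact: continuous_subspaceT.
- split; first by move=> x _; case: (dF x).
    by apply: cvg_at_right_filter; exact: cF.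
  by apply: cvg_at_left_filter; exact: cF.
- by move=> x _; rewrite derive1E; apply: derive_val.
Qed.

(** The bound B, constant over the compact interval of integration, is the
    dominating function of the theorem on differentiation under the integral
    sign. *)
Lemma rint_diff (k k' : R -> R -> R) (a b t B : R) :
  a < t < b ->
  (forall s, a < s < b -> continuous (k s)) ->
  (forall s x, a < s < b -> is_derive s 1 (fun s' => k s' x) (k' s x)) ->
  (forall s x, a < s < b -> `|k' s x| <= B) ->
  is_derive t 1 (fun s => rint (k s)) (rint (k' t)).
Proof.
move=> tab ck dk kB.
have dE s y : s \in `]a, b[%R -> partial1of2 k s y = k' s y.
  by rewrite in_itv /= => sab; rewrite partial1of2E; apply: (@derive_val _ _ _ _ _ _ _ (dk s y sab)).
have -> : rint (k' t) = \int[mu]_(y in I2pi) (partial1of2 k ^~ y) t.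
  by rewrite /rint; apply: eq_Rintegral => y _; rewrite dE.
have H1 s : `]a, b[%classic s -> mu.-integrable I2pi (EFin \o k s).
  by rewrite /= in_itv /= => sab; apply/integrable_cont/ck.
have H2 s y : `]a, b[%classic s -> I2pi y -> derivable (k ^~ y) s 1.
  by rewrite /= in_itv /= => sab _; case: (dk s y sab).
have H3 s y : `]a, b[%classic s -> I2pi y -> `|partial1of2 k s y| <= cst B y.
  by move=> sab _; rewrite dE //=; apply: kB; move: sab; rewrite /= in_itv.
have B0 (y : R) : 0 <= cst B y by apply: le_trans (kB t y tab).
have H4 : mu.-integrable I2pi (EFin \o cst B).
  by apply: integrable_cont; exact: cst_continuous.
have It : `]a, b[%classic t by rewrite /= in_itv.
split; last first.
  by rewrite -derive1E; exact: (@differentiation_under_integral R _ _ mu k I2pi (measurable_itv _) t a b It H1 H2 (cst B) B0 H4 H3).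
exact: (@derivable_under_integral R _ _ mu k I2pi (measurable_itv _) t a b It H1 H2 (cst B) B0 H4 H3).
Qed.

(** All contour integrals below run over a circle parametrized by [0, 2 pi], so
    a single interval of integration is enough. *)
Definition cint (g : R -> C) : R[i] :=
  rint (fun x => Re (g x)) +i* rint (fun x => Im (g x)).

Implicit Types g h : R -> C.

Lemma continuous_Re g : continuous g -> continuous (fun x => Re (g x)).
Proof. by move=> cg x; apply: continuous_ReP; exact: cg. Qed.

Lemma continuous_Im g : continuous g -> continuous (fun x => Im (g x)).
Proof. by move=> cg x; apply: continuous_ImP; exact: cg. Qed.

Local Hint Resolve continuous_Re continuous_Im : core.

Lemma cintD g h : continuous g -> continuous h ->
  cint (fun x => g x + h x) = cint g + cint h.
Proof.
move=> cg ch; rewrite /cint.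
have -> : (fun x => Re (g x + h x)) = (fun x => Re (g x) + Re (h x)).
  by apply/funext => x; case: (g x) (h x) => ? ? [].
have -> : (fun x => Im (g x + h x)) = (fun x => Im (g x) + Im (h x)).
  by apply/funext => x; case: (g x) (h x) => ? ? [].
rewrite rintD; [|exact: continuous_Re cg|exact: continuous_Re ch].
by rewrite rintD; [|exact: continuous_Im cg|exact: continuous_Im ch].
Qed.

Lemma cintZ (c : C) g : continuous g -> cint (fun x => c * g x) = c * cint g.
Proof.
move=> cg; rewrite /cint; case: c => a b; apply/eqP; rewrite eq_complex /=.
have crg := continuous_Re cg; have cig := continuous_Im cg.
have cZ (r : R) (f : R -> R) : continuous f -> continuous (fun x => r * f x).
  by move=> cf x; apply: cvgM; [exact: cvg_cst|exact: cf].
apply/andP; split; apply/eqP.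
  rewrite -mulNr -!rintZ // -rintD; [|exact: cZ|exact: cZ].
  by congr rint; apply/funext => x; case: (g x) => u v /=; rewrite mulNr.
rewrite -!rintZ // -rintD; [|exact: cZ|exact: cZ].
by congr rint; apply/funext => x; case: (g x) => u v /=.
Qed.

Lemma cint_sum n (G : 'I_n -> R -> C) : (forall i, continuous (G i)) ->
  cint (fun x => \sum_i G i x) = \sum_i cint (G i).
Proof.
elim: n G => [|n IH] G cG.
  rewrite big_ord0; under eq_fun do rewrite big_ord0.
  have := @cintZ 0 (fun=> 0) (fun x => @continuous_cstC C R x 0).
  by under eq_fun do rewrite mul0r; rewrite mul0r.
rewrite big_ord_recr /= -IH => [|i]; last exact: cG.
rewrite -cintD; last 2 first.
- move=> x; apply: (@continuous_sumK C R x _ _ (fun (i : 'I_n) y => G (widen_ord (leqnSn n) i) y)).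
  by move=> i; exact: cG.
- exact: cG.
by congr cint; apply/funext => x; rewrite big_ord_recr.
Qed.

Lemma cint_le g B : continuous g -> (forall x, nc (g x) <= B) ->
  nc (cint g) <= B * (pi *+ 4).
Proof.
move=> cg gB; apply: le_trans (nc_le _) _ => /=.
have -> : B * (pi *+ 4) = B * (pi *+ 2) + B * (pi *+ 2).
  by rewrite -mulrDr -mulrnDr.
apply: lerD; apply: rint_le; auto => x.
  by apply: le_trans (gB x); exact: ncRe.
by apply: le_trans (gB x); exact: ncIm.
Qed.

Lemma cint_FTC (F g : R -> C) : (forall x : R, rder F x (g x)) -> continuous g ->
  cint g = F (pi *+ 2) - F 0.
Proof.
move=> dF cg; rewrite /cint.
have -> := @rint_FTC (fun x => Re (F x)) _ (fun x => (dF x).1) (continuous_Re cg).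
have -> := @rint_FTC (fun x => Im (F x)) _ (fun x => (dF x).2) (continuous_Im cg).
by case: (F (pi *+ 2)) (F 0) => ? ? [? ?].
Qed.

Lemma cint_diff (k k' : R -> R -> C) (a b t B : R) :
  a < t < b ->
  (forall s, a < s < b -> continuous (k s)) ->
  (forall s x, a < s < b -> rder (fun s' => k s' x) s (k' s x)) ->
  (forall s x, a < s < b -> nc (k' s x) <= B) ->
  rder (fun s => cint (k s)) t (cint (k' t)).
Proof.
move=> tab ck dk kB; split.
  apply: (@rint_diff (fun s x => Re (k s x)) (fun s x => Re (k' s x)) a b t B) => //.
  - by move=> s sab; apply: continuous_Re; exact: ck.
  - by move=> s x sab; case: (dk s x sab).
  - by move=> s x sab; apply: le_trans (ncRe _) (kB s x sab).
apply: (@rint_diff (fun s x => Im (k s x)) (fun s x => Im (k' s x)) a b t B) => //.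
- by move=> s sab; apply: continuous_Im; exact: ck.
- by move=> s x sab; case: (dk s x sab).
- by move=> s x sab; apply: le_trans (ncIm _) (kB s x sab).
Qed.

Lemma rder0_cst (g : R -> C) (a b s t : R) : (forall x, a < x < b -> rder g x 0) ->
  a < s -> s <= t -> t < b -> g s = g t.
Proof.
move=> dg as_ st tb.
have H (f : R -> R) : (forall x, a < x < b -> is_derive x 1 f 0) -> f s = f t.
  move=> df.
  have inab x : x \in `[s, t]%R -> a < x < b.
    rewrite in_itv /= => /andP[sx xt].
    by rewrite (lt_le_trans as_) // (le_lt_trans xt).
  have [x|x|c _ ] := @MVT_segment R f (fun=> 0) s t st.
  - by move=> /subset_itv_oo_cc /inab /df.
  - apply/continuous_in_subspaceT => {}x /set_mem /= /inab /df[df' _].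
    exact/differentiable_continuous/derivable1_diffP.
  - by rewrite mul0r => /eqP; rewrite subr_eq0 => /eqP.
have hr := H (fun x => Re (g x)) (fun x xab => (dg x xab).1).
have hi := H (fun x => Im (g x)) (fun x xab => (dg x xab).2).
by apply/eqP; rewrite eq_complex hr hi !eqxx.
Qed.

End CircleIntegral.

(** * The Cauchy formula and Taylor expansions *)

(** The finite geometric expansion of the Cauchy kernel, with its remainder;
    summing it under the integral sign turns the Cauchy formula into a Taylor
    expansion. *)
Lemma geometric_split (F : fieldType) (g z : F) N : g != 0 -> g - z != 0 ->
  g / (g - z) = \sum_(n < N) z ^+ n * g^-1 ^+ n + (z * g^-1) ^+ N * (g / (g - z)).
Proof.
move=> g0 gz; elim: N => [|N IH]; first by rewrite big_ord0 add0r mul1r.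
rewrite {1}IH big_ord_recr /= -addrA; congr (_ + _).
have e : g / (g - z) = 1 + z * g^-1 * (g / (g - z)) by field; rewrite g0 gz.
by rewrite -exprMn {1}e mulrDr mulr1 mulrA -exprSr.
Qed.

Lemma geometric_le0 (R : realType) (q x B : R) : 0 <= q -> q < 1 ->
  (forall N, x <= B * q ^+ N) -> x <= 0.
Proof.
move=> q0 q1 h; rewrite leNgt; apply/negP => x0.
have := @cvg_geometric R B q; rewrite ger0_norm // => /(_ q1).
move=> /cvgrPdist_lt /(_ x x0)[N _ /(_ N (leqnn N))].
rewrite sub0r normrN => /(le_lt_trans (ler_norm _)).
by rewrite ltNge h.
Qed.

Section Cauchy.
Variable R : realType.
Local Notation C := (R[i] : numFieldType).
Implicit Types (f g : C -> C).

(** Holomorphic on the open disc of radius r centred at 0, with bounds on f and on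
    its derivative: the bound on the derivative is what dominates the integrals
    that are differentiated in the proof of the Cauchy formula. *)
Definition hol (r : R) f := exists (f' : C -> C) (M : R), forall z : C, nc z < r ->
  [/\ cder f z (f' z), {for z, continuous f'}, nc (f z) <= M & nc (f' z) <= M].

Definition circle (r t : R) : C := (r * cos t) +i* (r * sin t).

(** The inverse of the circle path, in real and imaginary parts so that its
    derivative is computed without a quotient rule. *)
Definition circleV (r t : R) : C := (r^-1 * cos t) -i* (r^-1 * sin t).

Lemma rder_circle r t : rder (circle r) t ('i * circle r t).
Proof.
split=> /=.
  have := @is_deriveZ R R R (@cos R) r t 1 (- sin t) (is_derive_cos t).
  by rewrite mul0r sub0r mul1r /GRing.scale /= mulrN.
have := @is_deriveZ R R R (@sin R) r t 1 (cos t) (is_derive_sin t).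
by rewrite mul0r add0r mul1r.
Qed.

Lemma rder_circleV r t : rder (circleV r) t (- 'i * circleV r t).
Proof.
split=> /=; last first.
  have -> : (fun s => - (r^-1 * sin s)) = (- r^-1) \*: (@sin R).
    by apply/funext => s /=; rewrite /GRing.scale /= mulNr.
  have := @is_deriveZ R R R (@sin R) (- r^-1) t 1 (cos t) (is_derive_sin t).
  by rewrite oppr0 mul0r add0r mulN1r /GRing.scale /= mulNr.
have := @is_deriveZ R R R (@cos R) r^-1 t 1 (- sin t) (is_derive_cos t).
by rewrite oppr0 mul0r sub0r mulN1r opprK /GRing.scale /= mulrN.
Qed.

Lemma nc_circle r t : 0 <= r -> nc (circle r t) = r.
Proof.
by move=> r0; rewrite /nc /= !exprMn -mulrDr cos2Dsin2 mulr1 sqrtr_sqr ger0_norm.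
Qed.

Lemma circle_neq0 r t : 0 < r -> circle r t != 0.
Proof. by move=> r0; rewrite -nc_gt0 nc_circle // ltW. Qed.

Lemma circleVE r t : 0 < r -> circleV r t = (circle r t)^-1.
Proof.
move=> r0; apply: (mulfI (circle_neq0 t r0)); rewrite divff ?circle_neq0 //.
have rr : r / r = 1 by rewrite divff // gt_eqF.
apply/eqP; rewrite eq_complex /=; apply/andP; split; apply/eqP.
  transitivity ((r / r) * ((cos t) ^+ 2 + (sin t) ^+ 2)); first ring.
  by rewrite cos2Dsin2 mulr1.
by ring.
Qed.

Lemma circle_2pi r : circle r (pi *+ 2) = circle r 0.
Proof. by rewrite /circle cos2pi sin2pi cos0 sin0. Qed.

Lemma circleV_2pi r : circleV r (pi *+ 2) = circleV r 0.
Proof. by rewrite /circleV cos2pi sin2pi cos0 sin0. Qed.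

Lemma continuous_circle r : continuous (circle r).
Proof. by move=> t; exact: rder_continuous (rder_circle r t). Qed.

Lemma continuous_circleV r : continuous (circleV r).
Proof. by move=> t; exact: rder_continuous (rder_circleV r t). Qed.

(** A negative power of the circle path has a primitive that is periodic. *)
Lemma cintVX (r : R) (n : nat) : cint (fun t => circleV r t ^+ n.+1) = 0.
Proof.
have dX t : rder (fun t => circleV r t ^+ n.+1) t
    (n.+1%:R * circleV r t ^+ n * (- 'i * circleV r t)).
  exact: (rder_comp (cderX (K := C) n.+1 (circleV r t)) (rder_circleV r t)).
have c0 : - 'i * n.+1%:R != 0 :> R[i].
  by rewrite mulf_neq0 ?pnatr_eq0 // oppr_eq0 eq_complex /= oner_eq0 andbF.
rewrite (@cint_FTC R (fun t => circleV r t ^+ n.+1 * (- 'i * n.+1%:R)^-1)).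
- by rewrite circleV_2pi subrr.
- move=> t; have := rderMc (- 'i * n.+1%:R)^-1 (dX t).
  congr (rder _ _ _); rewrite exprS.
  apply: (canLR (mulfK c0)); ring.
- by move=> t; exact: (rder_continuous (dX t)).
Qed.

Lemma cint_cst1 : cint (fun=> 1) = (pi *+ 2)%:C :> R[i].
Proof.
rewrite (@cint_FTC R (fun t => 0 + t%:C * 1)).
- by rewrite !add0r mulr1 mul0r subr0.
- by move=> x; exact: rder_affine.
- by move=> x; exact: (@continuous_cstC C).
Qed.

Section Kernel.
Variables (r : R) (zeta : C).
Hypotheses (r0 : 0 < r) (zr : nc zeta < r).
Let ga := circle r.
Let w (t : R) : C := ga t / (ga t - zeta).
Let q := nc zeta / r.

Lemma q_ge0 : 0 <= q. Proof. by rewrite divr_ge0 ?nc_ge0 // ltW. Qed.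
Lemma q_lt1 : q < 1. Proof. by rewrite ltr_pdivrMr // mul1r. Qed.

Lemma kernel_neq0 t : ga t - zeta != 0.
Proof.
rewrite subr_eq0; apply/eqP => E; move: zr; rewrite -E nc_circle ?ltxx //.
exact: ltW.
Qed.

Lemma continuous_kernel : continuous w.
Proof.
move=> t; apply: (@continuousMC C); first exact: continuous_circle.
apply: (@continuousVC C); last exact: kernel_neq0.
by apply: (@continuousDC C); [exact: continuous_circle|exact: (@continuous_cstC C)].
Qed.

Lemma nc_kernel t : nc (w t) <= r / (r - nc zeta).
Proof.
rewrite ncM ncV (nc_circle _ (ltW r0)); apply: ler_wpM2l; first exact: ltW.
rewrite lef_pV2 ?posrE ?subr_gt0 ?nc_gt0 ?kernel_neq0 //.
rewrite lerBlDr; apply: le_trans (ncD _ _).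
by rewrite subrK nc_circle // ltW.
Qed.

Lemma kernelE N t : w t = \sum_(n < N) zeta ^+ n * circleV r t ^+ n
  + (zeta * circleV r t) ^+ N * w t.
Proof.
by rewrite circleVE //; apply: geometric_split; [exact: circle_neq0|exact: kernel_neq0].
Qed.

(** The error term is the integral of the remainder of the geometric expansion; it
    is geometric in N because the modulus of zeta is smaller than r. *)
Lemma kernel_expansion (g : R -> C) (M : R) N : continuous g ->
  (forall t, nc (g t) <= M) ->
  nc (cint (fun t => g t * w t)
      - \sum_(n < N) zeta ^+ n * cint (fun t => g t * circleV r t ^+ n))
  <= M * (r / (r - nc zeta)) * q ^+ N * (pi *+ 4).
Proof.
move=> cg gM.
have cV n : continuous (fun t => circleV r t ^+ n : C).
  by move=> t; apply: (@continuous_comp_for _ C C _ _ (fun z : C => z ^+ n) (@continuous_circleV r t));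
    exact: (cder_continuous (cderX (K := C) n _)).
have cgV n : continuous (fun t => g t * circleV r t ^+ n : C).
  by move=> t; exact: (@continuousMC C R t g _ (cg t) (cV n t)).
have cZ n : continuous (fun t => zeta ^+ n * (g t * circleV r t ^+ n) : C).
  by move=> t; exact: (@continuousMC C R t _ _ (@continuous_cstC C R t _) (cgV n t)).
have cgw : continuous (fun t => g t * w t : C).
  by move=> t; exact: (@continuousMC C R t _ _ (cg t) (@continuous_kernel t)).
have cNV : continuous (fun t => zeta ^+ N * circleV r t ^+ N : C).
  by move=> t; exact: (@continuousMC C R t _ _ (@continuous_cstC C R t _) (cV N t)).
have cR : continuous (fun t => g t * w t * (zeta ^+ N * circleV r t ^+ N) : C).
  by move=> t; exact: (@continuousMC C R t _ _ (cgw t) (cNV t)).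
have cS : continuous (fun t => \sum_(n < N) zeta ^+ n * (g t * circleV r t ^+ n) : C).
  by move=> t; exact: (@continuous_sumK C R t _ _ (fun (n : 'I_N) s => zeta ^+ n * (g s * circleV r s ^+ n)) (fun n => cZ n t)).
have E1 := cintD cR cS.
have E2 := cint_sum (fun n : 'I_N => cZ n).
have -> : cint (fun t => g t * w t) =
    cint (fun t => g t * w t * (zeta ^+ N * circleV r t ^+ N)) +
    \sum_(n < N) zeta ^+ n * cint (fun t => g t * circleV r t ^+ n).
  transitivity (cint (fun t => g t * w t * (zeta ^+ N * circleV r t ^+ N) +
      \sum_(n < N) zeta ^+ n * (g t * circleV r t ^+ n))).
    congr cint; apply/funext => t; rewrite {1}(kernelE N) mulrDr addrC.
    congr (_ + _); first by rewrite exprMn mulrA [RHS]mulrAC.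
    by rewrite mulr_sumr; apply: eq_bigr => n _; rewrite mulrCA.
  rewrite E1 E2; congr (_ + _); apply: eq_bigr => n _.
  exact: (cintZ _ (cgV n)).
rewrite addrK; apply: (cint_le cR) => t.
rewrite ncM ncM -exprMn ncX.
have M0 : 0 <= M by apply: le_trans (gM 0); exact: nc_ge0.
apply: ler_pM; rewrite ?mulr_ge0 ?nc_ge0 ?exprn_ge0 ?nc_ge0 //.
  by apply: ler_pM; rewrite ?nc_ge0 ?nc_kernel.
by rewrite circleVE // ncM ncV nc_circle // ltW.
Qed.

(** In the expansion of the kernel only the constant term has a non-zero
    integral. *)
Lemma cint_kernel : cint w = (pi *+ 2)%:C :> R[i].
Proof.
have H N : nc (cint w - (pi *+ 2)%:C) <= (r / (r - nc zeta) * (pi *+ 4) * q) * q ^+ N.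
  have := @kernel_expansion (fun=> 1) 1 N.+1 (fun t => @continuous_cstC C R t _).
  have -> : \sum_(n < N.+1) zeta ^+ n * cint (fun t => 1 * circleV r t ^+ n) = (pi *+ 2)%:C.
    rewrite big_ord_recl expr0 mul1r big1 => [|n _].
      by rewrite addr0 -cint_cst1; congr cint; apply/funext => t; rewrite mul1r.
    have -> : (fun t => 1 * circleV r t ^+ (lift ord0 n)) = (fun t => circleV r t ^+ n.+1).
      by apply/funext => t; rewrite mul1r.
    by rewrite cintVX mulr0.
  have -> : (fun t => 1 * w t) = w by apply/funext => t; rewrite mul1r.
  move=> h; apply: le_trans (h _) _ => [_|]; first by rewrite nc1.
  by rewrite mul1r exprS; rewrite le_eqVlt; apply/orP; left; apply/eqP; ring.
apply/eqP; rewrite -subr_eq0 -nc_eq0 eq_le nc_ge0 andbT.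
exact: (geometric_le0 q_ge0 q_lt1 H).
Qed.

End Kernel.

Section Formula.
Variables (r rho : R) (f f' : C -> C) (M : R) (zeta : C).
Hypotheses (rho0 : 0 < rho) (rhor : rho < r) (zr : nc zeta < rho).
Hypothesis hf : forall z : C, nc z < r ->
  [/\ cder f z (f' z), {for z, continuous f'}, nc (f z) <= M & nc (f' z) <= M].
Let ga := circle rho.
Let w (t : R) : C := ga t / (ga t - zeta).
Let p (s t : R) : C := zeta + s%:C * (ga t - zeta).
Let d := (r - rho) / (2 * rho).

(** The segment from zeta to a point of the circle of radius rho can be prolonged a
    little at both ends inside the disc of radius r; the length d of the
    prolongation makes the range of s an open interval around [0, 1], as
    differentiation with respect to s requires. *)
Lemma nc_homotopy (s t : R) : - d < s < 1 + d -> nc (p s t) < r.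
Proof.
move=> /andP[sd s1].
have -> : p s t = (1 - s)%:C * zeta + s%:C * ga t.
  by rewrite /p rmorphB /= rmorph1; ring.
apply: le_lt_trans (ncD _ _) _; rewrite !ncM !nc_real (nc_circle _ (ltW rho0)).
have d0 : 0 < d by rewrite divr_gt0 ?subr_gt0 ?mulr_gt0.
have dE : (1 + 2 * d) * rho = r by rewrite /d; field; rewrite gt_eqF.
have h : `|1 - s| + `|s| < 1 + 2 * d.
  move: d sd s1 d0 => e sd s1 d0.
  by have [s0|s0] := ger0P s; have [s2|s2] := ger0P (1 - s); lra.
apply: (@le_lt_trans _ _ ((`|1 - s| + `|s|) * rho)).
  by rewrite mulrDl lerD2r ler_wpM2l // ltW.
by rewrite -[ltRHS]dE ltr_pM2r.
Qed.

Lemma rder_homotopy s t : rder (p s) t (s%:C * ('i * ga t)).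
Proof.
rewrite /p.
have -> : (fun t => zeta + s%:C * (ga t - zeta)) = (fun t => (zeta - s%:C * zeta) + s%:C * ga t).
  by apply/funext => u; ring.
exact: (rderMcD _ _ (rder_circle rho t)).
Qed.

Lemma continuous_homotopy s : continuous (p s).
Proof. by move=> t; exact: rder_continuous (rder_homotopy s t). Qed.

(** Up to the factor s times i, the integrand is the derivative of t |-> f (p s t),
    and p s is a closed path. At s = 0 the path is constant and the circle path
    itself has zero integral. *)
Lemma cint_derivative s : - d < s < 1 + d -> cint (fun t => f' (p s t) * ga t) = 0.
Proof.
move=> sd.
have cf : continuous (fun t => f' (p s t) * ga t : C).
  move=> t; have [_ cf' _ _] := hf (nc_homotopy t sd).
  have cc := @continuous_comp_for R C C t (p s) f' (@continuous_homotopy s t) cf'.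
  exact: (@continuousMC C R t _ _ cc (@continuous_circle rho t)).
have i0 : 'i != 0 :> R[i] by rewrite eq_complex /= oner_eq0 andbF.
have [s0|s0] := eqVneq s 0.
  have pE t : p s t = zeta by rewrite /p s0 mul0r addr0.
  rewrite (@cint_FTC R (fun t => 0 + (f' zeta / 'i) * ga t)); last exact: cf.
    by rewrite /ga circle_2pi subrr.
  move=> t; have := rderMcD 0 (f' zeta / 'i) (rder_circle rho t).
  by rewrite pE mulrA divfK.
have c0 : s%:C * 'i != 0 :> R[i].
  by rewrite mulf_neq0 // eq_complex /= eqxx andbT.
rewrite (@cint_FTC R (fun t => f (p s t) * (s%:C * 'i)^-1)); last exact: cf.
  by rewrite /p /ga circle_2pi subrr.
move=> t; have [df _ _ _] := hf (nc_homotopy t sd).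
have := rderMc (s%:C * 'i)^-1 (rder_comp df (rder_homotopy s t)).
congr (rder _ _ _); apply: (canLR (mulfK c0)); ring.
Qed.

(** Contract the circle to zeta along the paths p s. The integral of
    f (p s t) times the kernel has derivative zero in s, because the factor
    (circle - zeta) produced by the chain rule cancels the denominator of the
    kernel; so its value at s = 1 is its value at s = 0, which is f zeta times
    the integral of the kernel. *)
Lemma cauchy_formula : cint (fun t => f (ga t) * w t) = f zeta * (pi *+ 2)%:C.
Proof.
pose k s t := f (p s t) * w t.
pose k' s t := f' (p s t) * (ga t - zeta) * w t.
have cp s t : - d < s < 1 + d -> {for t, continuous (fun t => f (p s t))}.
  move=> sd; have [/cder_continuous cf _ _ _] := hf (nc_homotopy t sd).
  exact: (@continuous_comp_for R C C t (p s) f (@continuous_homotopy s t) cf).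
have cw := continuous_kernel rho0 zr.
have ck s : - d < s < 1 + d -> continuous (k s).
  by move=> sd t; exact: (@continuousMC C R t _ _ (cp s t sd) (cw t)).
have kE s t : k' s t = f' (p s t) * ga t.
  by rewrite /k' /w -mulrA; congr (_ * _); rewrite mulrC divfK // kernel_neq0.
have dk s t : - d < s < 1 + d -> rder (fun u => k u t) s (k' s t).
  move=> sd; have [df _ _ _] := hf (nc_homotopy t sd).
  exact: (rderMc (w t) (@rder_comp R f (fun u => p u t) s _ _ df (rder_affine zeta (ga t - zeta) s))).
have kB s t : - d < s < 1 + d -> nc (k' s t) <= M * rho.
  move=> sd; have [_ _ _ fM] := hf (nc_homotopy t sd).
  by rewrite kE ncM (nc_circle _ (ltW rho0)) ler_wpM2r // ltW.
have dK s : - d < s < 1 + d -> rder (fun u => cint (k u)) s 0.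
  move=> sd; have := cint_diff sd ck dk kB.
  by rewrite (_ : k' s = (fun t => f' (p s t) * ga t)) ?cint_derivative //; apply/funext.
have d0 : 0 < d by rewrite divr_gt0 ?subr_gt0 ?mulr_gt0.
have := @rder0_cst R (fun u => cint (k u)) (- d) (1 + d) 0 1 dK.
rewrite oppr_lt0 d0 ler01 ltrDl d0 => /(_ isT isT isT) K01.
transitivity (cint (k 1)).
  by congr cint; apply/funext => t; rewrite /k /p mul1r addrC subrK.
rewrite -K01 -(cint_kernel rho0 zr) -(cintZ _ cw).
by congr cint; apply/funext => t; rewrite /k /p mul0r addr0.
Qed.

End Formula.

(** The coefficients are the Cauchy integrals of f. The constant B serves both the
    Cauchy estimates and the remainder; the latter is stated for every zeta of
    the disc, so no convergence of series has to be discussed. *)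
Lemma hol_taylor r rho f : hol r f -> 0 < rho -> rho < r ->
  exists (a : nat -> R[i]) (B : R), [/\ 0 <= B,
    forall n, nc (a n) <= B * rho^-1 ^+ n
  & forall zeta N, nc zeta < rho ->
      nc (f zeta - \sum_(n < N) a n * zeta ^+ n) <=
        B * (rho / (rho - nc zeta)) * (nc zeta / rho) ^+ N].
Proof.
move=> [f' [M hf]] rho0 rhor.
have p2 : 0 < pi *+ 2 :> R by exact: pi2_gt0.
have cga t : nc (circle rho t) < r by rewrite (nc_circle _ (ltW rho0)).
have fM t : nc (f (circle rho t)) <= M by have [] := hf _ (cga t).
have M0 : 0 <= M by apply: le_trans (fM 0); exact: nc_ge0.
have cf : continuous (fun t => f (circle rho t)).
  move=> t; have [/cder_continuous cf _ _ _] := hf _ (cga t).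
  exact: (@continuous_comp_for R C C t (circle rho) f (@continuous_circle rho t) cf).
have cfV n : continuous (fun t => f (circle rho t) * circleV rho t ^+ n : C).
  move=> t; have cX := cder_continuous (cderX (K := C) n (circleV rho t)).
  have cV := @continuous_comp_for R C C t (circleV rho) (fun z : C => z ^+ n)
    (@continuous_circleV rho t) cX.
  exact: (@continuousMC C R t _ _ (cf t) cV).
pose c := (pi *+ 2)%:C^-1 : R[i].
have c0 : (pi *+ 2)%:C != 0 :> R[i] by rewrite eq_complex /= eqxx andbT gt_eqF.
have ncc : nc c = (pi *+ 2)^-1 by rewrite ncV nc_real gtr0_norm.
(* a complex integral is bounded by the bounds of its two parts, whence 4 pi and
   the factor 2 in the constant *)
have c4 : (pi *+ 2)^-1 * (pi *+ 4) = 2 :> R.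
  have p20 : pi *+ 2 != 0 :> R by rewrite gt_eqF.
  by rewrite -[4%N]/(2 * 2)%N mulrnA -[_ *+ 2 *+ 2]mulr_natr mulrA mulVf ?mul1r.
exists (fun n => c * cint (fun t => f (circle rho t) * circleV rho t ^+ n)), (2 * M); split.
- by rewrite mulr_ge0.
- move=> n; rewrite ncM ncc.
  have := @cint_le R _ (M * rho^-1 ^+ n) (cfV n).
  have H t : nc (f (circle rho t) * circleV rho t ^+ n) <= M * rho^-1 ^+ n.
    rewrite ncM ncX circleVE // ncV (nc_circle _ (ltW rho0)).
    by rewrite ler_wpM2r // exprn_ge0 // invr_ge0 ltW.
  move=> /(_ H) h; apply: (@le_trans _ _ ((pi *+ 2)^-1 * (M * rho^-1 ^+ n * (pi *+ 4)))).
    by rewrite ler_wpM2l // invr_ge0 ltW.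
  by rewrite mulrCA c4 mulrC mulrA.
- move=> zeta N zr.
  have := kernel_expansion rho0 zr N cf fM.
  rewrite (cauchy_formula rho0 rhor zr hf).
  set S := \sum_(n < N) zeta ^+ n * _ => h.
  have -> : \sum_(n < N) c * cint (fun t => f (circle rho t) * circleV rho t ^+ n) * zeta ^+ n
      = c * S.
    by rewrite mulr_sumr; apply: eq_bigr => n _; rewrite -mulrA [_ * zeta ^+ n]mulrC.
  have -> : f zeta - c * S = c * (f zeta * (pi *+ 2)%:C - S).
    by rewrite mulrBr [f zeta * _]mulrC mulKf.
  rewrite ncM ncc; apply: le_trans (ler_wpM2l _ h) _; first by rewrite invr_ge0 ltW.
  by rewrite mulrCA c4 le_eqVlt; apply/orP; left; apply/eqP; ring.
Qed.

End Cauchy.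

(** * Operations on holomorphic functions and the identity theorem *)

Section HolClosure.
Variable R : realType.
Local Notation C := (R[i] : numFieldType).
Implicit Types (f g : C -> C) (r : R).

Lemma hol_cst r (c : C) : hol r (fun=> c).
Proof.
exists (fun=> 0), (nc c) => z _; split; first exact: cder_cst.
- exact: (@continuous_cstC C).
- exact: lexx.
- by rewrite nc0 nc_ge0.
Qed.

Lemma hol_id r : hol r (fun z => z).
Proof.
exists (fun=> 1), (Num.max r 1) => z zr; split; first exact: cder_id.
- exact: (@continuous_cstC C).
- by rewrite le_max (ltW zr).
- by rewrite nc1 le_max lexx orbT.
Qed.

Lemma holD r f g : hol r f -> hol r g -> hol r (fun z => f z + g z).
Proof.
move=> [f' [M hf]] [g' [N hg]].
exists (fun z => f' z + g' z), (M + N) => z zr.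
have [df cf fM f'M] := hf z zr; have [dg cg gN g'N] := hg z zr; split.
- exact: cderD df dg.
- exact: (@continuousDC C C z _ _ cf cg).
- by apply: le_trans (ncD _ _) _; exact: lerD.
- by apply: le_trans (ncD _ _) _; exact: lerD.
Qed.

Lemma holM r f g : hol r f -> hol r g -> hol r (fun z => f z * g z).
Proof.
move=> [f' [M hf]] [g' [N hg]].
exists (fun z => f' z * g z + f z * g' z), (M * N + M * N) => z zr.
have [df cf fM f'M] := hf z zr; have [dg cg gN g'N] := hg z zr.
have M0 : 0 <= M by apply: le_trans fM; exact: nc_ge0.
have N0 : 0 <= N by apply: le_trans gN; exact: nc_ge0.
split.
- exact: cderM df dg.
- apply: (@continuousDC C C z (fun z => f' z * g z) (fun z => f z * g' z)).
    exact: (@continuousMC C C z _ _ cf (cder_continuous dg)).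
  exact: (@continuousMC C C z _ _ (cder_continuous df) cg).
- rewrite ncM; apply: (@le_trans _ _ (M * N)); last by rewrite lerDl mulr_ge0.
  by apply: ler_pM; rewrite ?nc_ge0.
- apply: le_trans (ncD _ _) _; rewrite !ncM.
  by apply: lerD; apply: ler_pM; rewrite ?nc_ge0.
Qed.

Lemma holX r f n : hol r f -> hol r (fun z => f z ^+ n).
Proof.
move=> hf; elim: n => [|n IH].
  have -> : (fun z => f z ^+ 0) = (fun=> 1) by apply/funext => z; rewrite expr0.
  exact: hol_cst.
have -> : (fun z => f z ^+ n.+1) = (fun z => f z * f z ^+ n).
  by apply/funext => z; rewrite exprS.
exact: holM.
Qed.

Lemma hol_sum r (I : Type) (s : seq I) (F : I -> C -> C) :
  (forall i, hol r (F i)) -> hol r (fun z => \sum_(i <- s) F i z).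
Proof.
move=> hF; elim: s => [|i s IH].
  have -> : (fun z => \sum_(i <- [::]) F i z) = (fun=> 0).
    by apply/funext => z; rewrite big_nil.
  exact: hol_cst.
have -> : (fun z => \sum_(j <- i :: s) F j z) = (fun z => F i z + \sum_(j <- s) F j z).
  by apply/funext => z; rewrite big_cons.
exact: holD.
Qed.

Lemma hol_prod r (I : Type) (s : seq I) (F : I -> C -> C) :
  (forall i, hol r (F i)) -> hol r (fun z => \prod_(i <- s) F i z).
Proof.
move=> hF; elim: s => [|i s IH].
  have -> : (fun z => \prod_(i <- [::]) F i z) = (fun=> 1).
    by apply/funext => z; rewrite big_nil.
  exact: hol_cst.
have -> : (fun z => \prod_(j <- i :: s) F j z) = (fun z => F i z * \prod_(j <- s) F j z).
  by apply/funext => z; rewrite big_cons.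
exact: holM.
Qed.

Lemma hol_affine r s f (a b : C) : hol r f ->
  (forall z, nc z < s -> nc (a * z + b) < r) -> hol s (fun z => f (a * z + b)).
Proof.
move=> [f' [M hf]] hab; exists (fun z => f' (a * z + b) * a), (Num.max M (M * nc a)).
move=> z /hab zs; have [df cf fM f'M] := hf _ zs; split.
- exact: cder_affine.
- apply: (@continuousMC C C z (fun z => f' (a * z + b)) (fun=> a)); last first.
    exact: (@continuous_cstC C).
  exact: (@continuous_comp_for C C C z (fun z => a * z + b) f' (@continuous_affine C a b z) cf).
- by rewrite le_max fM.
- by rewrite ncM le_max ler_wpM2r ?orbT ?nc_ge0.
Qed.

Lemma hol_conj r f : hol r f -> hol r (fun z => conjc (f (conjc z))).
Proof.
move=> [f' [M hf]]; exists (fun z => conjc (f' (conjc z))), M => z zr.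
have := hf (conjc z); rewrite ncJ => /(_ zr)[df cf fM f'M]; split.
- exact: cder_conj.
- have cz := @continuous_conj R C z (fun z => z) (@continuous_idC C z).
  have cc := @continuous_comp_for C C C z _ f' cz cf.
  exact: (@continuous_conj R C z _ cc).
- by rewrite ncJ.
- by rewrite ncJ.
Qed.

Lemma le0_of_le_small (c D d : R) : 0 < d -> (forall x, 0 < x < d -> c <= D * x) -> c <= 0.
Proof.
move=> d0 h; rewrite leNgt; apply/negP => c0.
pose x := Num.min (d / 2) (c / (2 * (`|D| + 1))).
have D0 : 0 < `|D| + 1 by rewrite ltr_wpDl.
have x0 : 0 < x by rewrite lt_min !divr_gt0 ?mulr_gt0.
have xd : x < d by rewrite /x gt_min ltr_pdivrMr // mulr_natr mulr2n ltrDl d0.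
have := h x; rewrite x0 xd => /(_ isT); apply/negP; rewrite -ltNge.
have xc : x <= c / (2 * (`|D| + 1)) by rewrite /x ge_min lexx orbT.
apply: (@le_lt_trans _ _ ((`|D| + 1) * x)).
  by apply: ler_wpM2r; [exact: ltW|apply: le_trans (ler_norm D) _; rewrite lerDl].
apply: (@le_lt_trans _ _ ((`|D| + 1) * (c / (2 * (`|D| + 1))))).
  by apply: ler_wpM2l => //; exact: ltW.
have -> : (`|D| + 1) * (c / (2 * (`|D| + 1))) = c / 2 by field; rewrite gt_eqF.
by rewrite ltr_pdivrMr // mulr_natr mulr2n ltrDl.
Qed.

(** The Taylor coefficients vanish one after the other: if the first n vanish, the
    expansion at small real x reads |a n| x^n = O(x^(n+1)). *)
Lemma identity_theorem r f : hol r f ->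
  (forall x : R, `|x| < r -> f x%:C = 0 :> R[i]) ->
  forall z, nc z < r -> f z = 0 :> R[i].
Proof.
move=> hf f0 z zr.
(* a circle between z and the boundary of the disc *)
pose rho := (nc z + r) / 2.
have r0 : 0 < r by apply: le_lt_trans zr; exact: nc_ge0.
have rho0 : 0 < rho by rewrite divr_gt0 // ltr_wpDl ?nc_ge0.
have rhor : rho < r by rewrite /rho ltr_pdivrMr // mulr_natr mulr2n ltrD2r.
have zrho : nc z < rho by rewrite /rho ltr_pdivlMr // mulr_natr mulr2n ltrD2l.
have [a [B [B0 aB hB]]] := hol_taylor hf rho0 rhor.
have a0 n : a n = 0.
  elim/ltn_ind: n => n IH; apply/eqP; rewrite -nc_eq0 eq_le nc_ge0 andbT.
  apply: (@le0_of_le_small _ (B * 2 * rho^-1 ^+ n.+1) (rho / 2)); first by rewrite divr_gt0.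
  move=> x /andP[x0 xrho].
  have xr : x < rho by apply: lt_trans xrho _; rewrite ltr_pdivrMr // mulr_natr mulr2n ltrDl.
  have ncx : nc x%:C = x by rewrite nc_real gtr0_norm.
  have := hB x%:C n.+1; rewrite ncx => /(_ xr).
  rewrite f0 ?gtr0_norm ?(lt_trans xr) // big_ord_recr big1 /= => [|i _]; last first.
    by rewrite IH ?mul0r.
  rewrite !add0r ncN ncM ncX ncx.
  have rx : rho / (rho - x) <= 2.
    by rewrite ler_pdivrMr ?subr_gt0 //; move: xrho; rewrite ltr_pdivlMr //; lra.
  move=> h; rewrite -(ler_pM2r (exprn_gt0 n x0)); apply: le_trans h _.
  have -> : B * 2 * rho^-1 ^+ n.+1 * x * x ^+ n = B * 2 * (x / rho) ^+ n.+1.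
    by rewrite exprMn [x ^+ n.+1]exprS; ring.
  apply: ler_wpM2r; last exact: ler_wpM2l.
  by apply/exprn_ge0/divr_ge0; exact: ltW.
apply/eqP; rewrite -nc_eq0 eq_le nc_ge0 andbT.
apply: (@geometric_le0 R (nc z / rho) _ (B * (rho / (rho - nc z)))).
- by rewrite divr_ge0 ?nc_ge0 // ltW.
- by rewrite ltr_pdivrMr // mul1r.
- move=> N; have := hB z N zrho; rewrite big1 ?subr0 // => i _.
  by rewrite a0 mul0r.
Qed.

End HolClosure.

(** * The Cauchy-Riemann equations *)

Section C1Hol.
Variable R : realType.
Local Notation C := (R[i] : numFieldType).

(** The mean value theorem on the segment between 0 and b, whatever the sign of
    b. *)
Lemma MVT_sym (S S' : R -> R) (b : R) :
  (forall s : R, `|s| <= `|b| -> is_derive s 1 S (S' s)) ->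
  exists2 c, `|c| <= `|b| & S b - S 0 = S' c * b.
Proof.
move=> dS.
have cS a c : (forall x, x \in `[a, c]%R -> `|x| <= `|b|) ->
    {within `[a, c], continuous S}.
  move=> h; apply/continuous_in_subspaceT => x /set_mem /= /h /dS[dx _].
  exact/differentiable_continuous/derivable1_diffP.
have [b0|b0] := lerP 0 b.
  have H x : x \in `[0, b]%R -> `|x| <= `|b|.
    by rewrite in_itv /= => /andP[x0 xb]; rewrite !ger0_norm.
  have [x /subset_itv_oo_cc /H /dS //||c /H cb ->] := @MVT_segment R S S' 0 b b0.
    exact: cS.
  by exists c => //; rewrite subr0.
have H x : x \in `[b, 0]%R -> `|x| <= `|b|.
  by rewrite in_itv /= => /andP[bx x0]; rewrite !ler0_norm ?lerN2 // ltW.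
have [x /subset_itv_oo_cc /H /dS //||c /H cb E] := @MVT_segment R S S' b 0 (ltW b0).
  exact: cS.
by exists c => //; rewrite -opprB E sub0r mulrN opprK.
Qed.

Lemma is_derive_translate (S : R -> R) (s : R) :
  derivable (fun t => S (s + t)) 0 1 ->
  is_derive s 1 S (derive1 (fun t => S (s + t)) 0).
Proof.
move=> dS.
have : is_derive (0 : R) 1 (fun t => S (s + t)) (derive1 (fun t => S (s + t)) 0).
  by rewrite derive1E; exact: DeriveDef.
move=> /is_derive1_caratheodory[g [gE cg g0]].
apply/is_derive1_caratheodory; exists (fun y => g (y - s)); split.
- by move=> y; have := gE (y - s); rewrite addr0 subr0 [s + _]addrC subrK.
- have cg' : {for s - s, continuous g} by rewrite subrr.
  have cs : {for s, continuous (fun y : R => y - s)}.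
    by apply: (@cvgB R R R (nbhs s) _ (fun y => y) (fun=> s)); [exact: cvg_id|exact: cvg_cst].
  exact: (@continuous_comp_for R R R s _ g cs cg').
- by rewrite subrr.
Qed.

(** Go from z to w first horizontally, then vertically, and apply the mean value
    theorem on each leg: the partial derivatives at the intermediate points are
    close to those at z. *)
Lemma C1_differentiable (D : set C) (u : C -> R) (z : C) (e : R) :
  open D -> C1_on D u -> D z -> 0 < e ->
  exists2 d : R, 0 < d & forall w, nc (w - z) < d ->
    `|u w - u z - (d_alpha u z * Re (w - z) + d_beta u z * Im (w - z))|
      <= e * nc (w - z).
Proof.
move=> oD hu Dz e0.
have [_ _ ca cb] := hu z Dz.
have e2 : 0 < e / 2 by rewrite divr_gt0.
have /nbhsCP[d1 d10 hd1] : nbhs z D by exact: open_nbhs_nbhs.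
have /(nbhsCP z)[d2 d20 hd2] :
    nbhs (z : C) [set w : C | `|d_alpha u z - d_alpha u w| < e / 2].
  by move/cvgrPdist_lt : ca; apply.
have /(nbhsCP z)[d3 d30 hd3] :
    nbhs (z : C) [set w : C | `|d_beta u z - d_beta u w| < e / 2].
  by move/cvgrPdist_lt : cb; apply.
exists (Num.min d1 (Num.min d2 d3)); first by rewrite !lt_min d10 d20.
move=> w; rewrite !lt_min => /and3P[w1 w2 w3].
set a := Re (w - z); set b := Im (w - z).
have near_ (a' b' : R) : `|a'| <= `|a| -> `|b'| <= `|b| ->
    nc ((z + (a' +i* b')) - z) <= nc (w - z).
  move=> aa bb; rewrite addrAC subrr add0r.
  have -> : w - z = a +i* b by rewrite /a /b; case: (w - z).
  rewrite /nc /= ler_wsqrtr //.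
  by apply: lerD; rewrite -[leLHS]real_normK ?num_real // -[leRHS]real_normK ?num_real //
    ler_sqr ?nnegrE.
have dA (s : R) : `|s| <= `|a| ->
    is_derive s 1 (fun t => u (z + (t +i* 0))) (d_alpha u (z + (s +i* 0))).
  move=> sa.
  have Dw : D (z + (s +i* 0)).
    by apply: hd1; apply: le_lt_trans w1; apply: near_ => //; rewrite normr0.
  have [da _ _ _] := hu _ Dw.
  have E : line_alpha u (z + (s +i* 0)) = (fun t => u (z + ((s + t) +i* 0))).
    apply/funext => t; rewrite /line_alpha -addrA; congr (u (_ + _)).
    by apply/eqP; rewrite eq_complex /= addr0 !eqxx.
  rewrite /d_alpha E; apply: (@is_derive_translate (fun t => u (z + (t +i* 0)))).
  by rewrite -E.
have dB (s : R) : `|s| <= `|b| ->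
    is_derive s 1 (fun t => u (z + (a +i* t))) (d_beta u (z + (a +i* s))).
  move=> sb.
  have Dw : D (z + (a +i* s)).
    by apply: hd1; apply: le_lt_trans w1; exact: near_.
  have [_ db _ _] := hu _ Dw.
  have E : line_beta u (z + (a +i* s)) = (fun t => u (z + (a +i* (s + t)))).
    apply/funext => t; rewrite /line_beta -addrA; congr (u (_ + _)).
    by apply/eqP; rewrite eq_complex /= addr0 !eqxx.
  rewrite /d_beta E; apply: (@is_derive_translate (fun t => u (z + (a +i* t)))).
  by rewrite -E.
have [s sa Ea] := MVT_sym dA.
have [t tb Eb] := MVT_sym dB.
have wE : w = z + (a +i* b).
  by rewrite /a /b; rewrite -[LHS](subrK z) addrC; congr (_ + _); case: (w - z).
have zE : z + (0 +i* 0) = z by rewrite -[RHS]addr0; congr (_ + _).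
rewrite zE in Ea; rewrite -wE in Eb.
have -> : u w - u z - (d_alpha u z * a + d_beta u z * b) =
    (d_alpha u (z + (s +i* 0)) - d_alpha u z) * a +
    (d_beta u (z + (a +i* t)) - d_beta u z) * b.
  have -> : u w - u z = (u w - u (z + (a +i* 0))) + (u (z + (a +i* 0)) - u z) by ring.
  by rewrite Ea Eb; ring.
apply: le_trans (ler_normD _ _) _; rewrite !normrM.
rewrite [e in leRHS]splitr mulrDl.
apply: lerD; apply: ler_pM => //.
- rewrite distrC; apply/ltW/hd2; apply: le_lt_trans w2; apply: near_ => //.
  by rewrite normr0.
- exact: ncRe.
- by rewrite distrC; apply/ltW/hd3; apply: le_lt_trans w3; exact: near_.
- exact: ncIm.
Qed.

(** The difference quotient, given the value d at z, is continuous there. *)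
Lemma cderP (f : C -> C) (z d : R[i]) :
  (forall e : R, 0 < e -> exists2 del : R, 0 < del & forall w, nc (w - z) < del ->
     nc (f w - f z - d * (w - z)) <= e * nc (w - z)) -> cder f z d.
Proof.
move=> h; exists (fun w => if w == z then d else (f w - f z) / (w - z)); split.
- move=> w; case: eqVneq => [->|wz]; first by rewrite !subrr mulr0.
  by rewrite divfK // subr_eq0.
- apply/(@continuousCP R C) => e e0.
  have e2 : 0 < e / 2 by rewrite divr_gt0.
  have [del del0 hd] := h _ e2.
  apply/nbhsCP; exists del => // w wd; rewrite eqxx.
  case: eqVneq => [_|wz]; first by rewrite subrr nc0.
  have wz0 : 0 < nc (w - z) by rewrite nc_gt0 subr_eq0.
  have -> : (f w - f z) / (w - z) - d = (f w - f z - d * (w - z)) / (w - z).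
    by rewrite [RHS]mulrBl mulfK // subr_eq0.
  rewrite ncM ncV ltr_pdivrMr //; apply: le_lt_trans (hd w wd) _.
  by rewrite ltr_pM2r // ltr_pdivrMr // mulr_natr mulr2n ltrDl.
- by rewrite eqxx.
Qed.

(** By the Cauchy-Riemann equations the real differential of u + i v is the
    multiplication by the complex number d_alpha u + i d_alpha v. The disc is
    shrunk so that the function and its derivative are bounded on it, which
    follows from their continuity at z0. *)
Lemma C1_CR_hol (D : set C) (u v : C -> R) (z0 : C) :
  open D -> D z0 -> C1_on D u -> C1_on D v ->
  (forall z, D z -> d_alpha u z = d_beta v z /\ d_alpha v z = - d_beta u z) ->
  exists2 r : R, 0 < r & hol r (fun z => u (z + z0) +i* v (z + z0) : C).
Proof.
move=> oD Dz0 hu hv CR.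
pose f (z : C) : C := u z +i* v z.
pose f' (z : C) : C := d_alpha u z +i* d_alpha v z.
have df z : D z -> cder f z (f' z).
  move=> Dz; apply: cderP => e e0.
  have e2 : 0 < e / 2 by rewrite divr_gt0.
  have [d1 d10 h1] := C1_differentiable oD hu Dz e2.
  have [d2 d20 h2] := C1_differentiable oD hv Dz e2.
  exists (Num.min d1 d2); first by rewrite lt_min d10.
  move=> w; rewrite lt_min => /andP[w1 w2].
  apply: le_trans (nc_le _) _; rewrite [e in leRHS]splitr mulrDl.
  have [E1 E2] := CR z Dz.
  apply: lerD.
    apply: le_trans (h1 w w1); rewrite le_eqVlt; apply/orP; left; apply/eqP; congr `|_|.
    rewrite /f /f' E2; case: (w - z) => a b /=; ring.
  apply: le_trans (h2 w w2); rewrite le_eqVlt; apply/orP; left; apply/eqP; congr `|_|.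
  rewrite /f /f' -E1; case: (w - z) => a b /=; ring.
have cf' z : D z -> {for z, continuous f'}.
  move=> Dz; have [_ _ cu _] := hu z Dz; have [_ _ cv _] := hv z Dz.
  exact: (@continuous_parts R C z f').
have [d1 d10 h1] : exists2 d1 : R, 0 < d1 & forall w, nc (w - z0) < d1 -> D w.
  by apply/nbhsCP; exact: open_nbhs_nbhs.
have bnd (g : C -> C) : {for z0, continuous g} ->
    exists2 d : R, 0 < d & forall w, nc (w - z0) < d -> nc (g w) <= nc (g z0) + 1.
  move=> /(@continuousCP R C) /(_ 1 ltr01) /nbhsCP[d d0 hd]; exists d => // w /hd gw.
  by rewrite -[g w](subrK (g z0)) addrC; apply: le_trans (ncD _ _) _; rewrite lerD2l ltW.
have [d2 d20 h2] := bnd _ (cder_continuous (df _ Dz0)).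
have [d3 d30 h3] := bnd _ (cf' _ Dz0).
exists (Num.min d1 (Num.min d2 d3)); first by rewrite !lt_min d10 d20.
exists (fun z => f' (z + z0)), (Num.max (nc (f z0) + 1) (nc (f' z0) + 1)).
move=> z; rewrite !lt_min => /and3P[z1 z2 z3].
have zE : z = z + z0 - z0 by rewrite addrK.
rewrite zE in z1 z2 z3.
have Dz := h1 _ z1; split.
- have aE (w : C) : 1 * w + z0 = w + z0 by rewrite mul1r.
  have := @cder_affine C f 1 z0 z (f' (z + z0)); rewrite mulr1 aE => /(_ (df _ Dz)).
  by congr (cder _ _ _); apply/funext => w; rewrite aE.
- have cz := @continuousDC C C z _ _ (@continuous_idC C z) (@continuous_cstC C C z z0).
  exact: (@continuous_comp_for C C C z _ f' cz (cf' _ Dz)).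
- by rewrite le_max h2.
- by rewrite le_max h3 ?orbT.
Qed.

End C1Hol.

(** * Unconditional summability of Taylor series *)

Section HolAnalytic.
Variable R : realType.
Local Notation C := (R[i] : numFieldType).

(** A multi-index in one variable is a natural number: a sum over a finite set of
    multi-indices is a sum over a part of an initial segment. *)
Lemma sum_fset_nat (V : zmodType) (T : nat -> V) (A : {fset {ffun 'I_1 -> nat}}) (L : nat) :
  (forall al, al \in A -> (al ord0 < L)%N) ->
  \sum_(i : A) T (val i ord0) =
  \sum_(0 <= n < L | n \in [seq (al : {ffun 'I_1 -> nat}) ord0 | al <- enum_fset A]) T n.
Proof.
move=> AL; set s := map _ _.
rewrite -(big_seq_fsetE _ A predT (fun al : {ffun 'I_1 -> nat} => T (al ord0))) /=.
transitivity (\sum_(n <- s) T n); first by rewrite big_map.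
rewrite -[RHS]big_filter; apply: perm_big; apply: uniq_perm.
- rewrite map_inj_uniq ?fset_uniq // => al be ab.
  by apply/ffunP => i; rewrite (ord1 i).
- by rewrite filter_uniq // iota_uniq.
- move=> n; rewrite mem_filter mem_index_iota leq0n /=.
  case: (boolP (n \in s)) => //= /mapP[al alA ->].
  by rewrite AL.
Qed.

Lemma geometric_sum_le (q : R) (N L : nat) (P : pred nat) : 0 <= q -> q < 1 -> (N <= L)%N ->
  \sum_(N <= n < L | P n) q ^+ n <= q ^+ N / (1 - q).
Proof.
move=> q0 q1 NL; have q1' : 0 < 1 - q by rewrite subr_gt0.
apply: (@le_trans _ _ (\sum_(N <= n < L) q ^+ n)).
  rewrite big_mkcond; apply: ler_sum => n _; case: ifP => // _.
  exact: exprn_ge0.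
suff -> : \sum_(N <= n < L) q ^+ n = (q ^+ N - q ^+ L) / (1 - q).
  by rewrite ler_pM2r ?invr_gt0 // lerBlDr lerDl exprn_ge0.
rewrite -(subnKC NL); elim: (L - N)%N => [|k IH].
  by rewrite addn0 big_geq // subrr mul0r.
rewrite addnS big_nat_recr ?leq_addr //= IH exprS.
by field; rewrite gt_eqF.
Qed.

(** A finite set of exponents that contains 0, ..., N - 1 gives the Taylor sum of
    order N plus terms of order at least N. Both the Taylor remainder and these
    terms are at most a constant times q^N, with q smaller than 1. *)
Lemma hol_analytic (h : C -> C) (a : 'rV[C]_1) (r : R) : 0 < r ->
  hol r (fun z => h (z + a 0 0)) -> analytic_at (fun x : 'rV[C]_1 => h (x 0 0)) a.
Proof.
move=> r0 hf; pose rho := r / 2.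
have rho0 : 0 < rho by rewrite divr_gt0.
have rhor : rho < r by rewrite ltr_pdivrMr // mulr_natr mulr2n ltrDl.
have [c [B [B0 cB hB]]] := hol_taylor hf rho0 rhor.
exists (fun al : {ffun 'I_1 -> nat} => c (al ord0)), (rho / 2)%:C; split.
  by rewrite ltcR divr_gt0.
move=> x /(_ ord0); rewrite normC_nc ltcR => xr.
set z := x 0 ord0 in xr *.
have q2 : nc z / rho < 2^-1.
  by rewrite ltr_pdivrMr // mulrC.
pose q := nc z / rho.
have q0 : 0 <= q by rewrite divr_ge0 ?nc_ge0 // ltW.
have q1 : q < 1 by apply: lt_trans q2 _; rewrite invf_lt1 ?ltr1n.
have zr : nc z < rho by apply: lt_trans xr _; rewrite ltr_pdivrMr // mulr_natr mulr2n ltrDl.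
have -> : h ((a + x) 0 0) = h (z + a 0 0) by rewrite mxE addrC.
pose D := B * (rho / (rho - nc z)) + B / (1 - q).
apply/(@cvgCP R _ _ (totally_filter (I := {ffun 'I_1 -> nat}))) => e e0.
have [N hN] : exists N, D * q ^+ N < e.
  have := @cvg_geometric R D q; rewrite ger0_norm // => /(_ q1).
  move=> /cvgrPdist_lt /(_ e e0)[N _ /(_ N (leqnn N))].
  by rewrite sub0r normrN => /(le_lt_trans (ler_norm _)); exists N.
exists (seq_fset tt [seq [ffun=> n] | n <- iota 0 N]) => // A /fsubsetP sub /=.
have AN n : (n < N)%N -> [ffun=> n] \in A.
  by move=> nN; apply: sub; rewrite seq_fsetE map_f // mem_iota.
pose T n := c n * z ^+ n.
(* an exponent beyond N and all those of A *)
pose L := maxn N (\max_(al <- enum_fset A) ((al : {ffun 'I_1 -> nat}) ord0)).+1.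
have AL al : al \in A -> (al ord0 < L)%N.
  move=> alA; rewrite leq_max; apply/orP; right; rewrite ltnS.
  exact: (@leq_bigmax_seq _ (enum_fset A) predT (fun al : {ffun 'I_1 -> nat} => al ord0) al alA isT).
have NL : (N <= L)%N by rewrite leq_maxl.
rewrite /partial_sum.
have -> : \sum_(i : A) c (val i ord0) * \prod_(j < 1) x 0 j ^+ (val i) j =
    \sum_(i : A) T (val i ord0).
  by apply: eq_bigr => i _; rewrite big_ord1.
rewrite (sum_fset_nat T AL); set s := map _ _.
rewrite (big_cat_nat (leq0n N) NL) /=.
have -> : \sum_(0 <= n < N | n \in s) T n = \sum_(n < N) T n.
  rewrite -[RHS](big_mkord predT T) [LHS]big_nat_cond [RHS]big_nat_cond.
  apply: eq_bigl => n; rewrite leq0n andbT /=.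
  case: (boolP (n < N)%N) => //= nN.
  suff -> : n \in s by [].
  by apply/mapP; exists [ffun=> n]; [exact: AN|rewrite ffunE].
rewrite addrAC; apply: le_lt_trans (ncD _ _) _.
apply: le_lt_trans hN; rewrite mulrDl; apply: lerD.
  rewrite ncC; exact: hB.
apply: le_trans (nc_sum _ _ _) _.
apply: (@le_trans _ _ (\sum_(N <= n < L | n \in s) B * q ^+ n)).
  apply: ler_sum => n _; rewrite ncM ncX.
  have -> : B * q ^+ n = B * rho^-1 ^+ n * nc z ^+ n.
    by rewrite exprMn mulrAC mulrA.
  by rewrite ler_wpM2r ?exprn_ge0 ?nc_ge0.
rewrite -mulr_sumr -mulrA [_^-1 * _]mulrC ler_wpM2l //.
exact: geometric_sum_le.
Qed.

End HolAnalytic.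

(** * Continuity of real analytic functions along lines *)

Section UnconditionalSums.
Variables (R : realType) (I : choiceType).
Implicit Types (b : I -> R) (A B : {fset I}).

Lemma partial_sumE (V : zmodType) (x : I -> V) A :
  partial_sum x A = \sum_(i <- enum_fset A) x i.
Proof. by rewrite /partial_sum -(big_seq_fsetE _ A predT x). Qed.

(** Unconditional convergence is absolute convergence. The sums over the finite
    sets that contain some fixed A0 are within 1 of the limit, so the sums over
    all finite sets are bounded; the positive and the negative terms of b are
    then bounded separately. *)
Lemma unconditional_sum_abs b (l : R) : partial_sum b @ totally --> l ->
  exists M : R, forall B, \sum_(i <- enum_fset B) `|b i| <= M.
Proof.
move=> /(@cvgrPdist_lt _ _ _ _ totally_filter) /(_ 1 ltr01)[A0 _ hA0].
have bnd B : `|\sum_(i <- enum_fset B) b i| <=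
    `|l| + 1 + \sum_(i <- enum_fset A0) `|b i|.
  have /hA0 /= : (A0 `<=` B `|` A0)%fset by exact: fsubsetUr.
  rewrite partial_sumE (big_fsetID _ (mem B)) /=.
  have -> : [fset x in B `|` A0 | x \in B]%fset = B.
    by apply/fsetP => x; rewrite !inE; case: (x \in B); rewrite ?andbF.
  set T := (X in _ - (_ + X)) => h.
  have TB : `|T| <= \sum_(i <- enum_fset A0) `|b i|.
    rewrite /T; have -> : [fset x in B `|` A0 | x \notin B]%fset = [fset x in A0 | x \notin B]%fset.
      by apply/fsetP => x; rewrite !inE; case: (x \in B); rewrite ?andbF.
    rewrite -big_fset_condE; apply: le_trans (ler_norm_sum _ _ _) _.
    by rewrite [leRHS](bigID (fun x => x \notin B)) /= lerDl sumr_ge0.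
  set S := (X in _ - (X + _)) in h *.
  change (`|S| <= `|l| + 1 + \sum_(i <- enum_fset A0) `|b i|).
  have -> : S = l - (l - (S + T)) - T by ring.
  apply: le_trans (ler_normB _ _) (lerD _ TB).
  by apply: le_trans (ler_normB _ _) _; rewrite lerD2l ltW.
pose M := `|l| + 1 + \sum_(i <- enum_fset A0) `|b i|; exists (M + M) => B.
rewrite (bigID (fun i => 0 <= b i)) /=; apply: lerD.
  rewrite (eq_bigr b) => [|i bi]; last by rewrite ger0_norm.
  by rewrite big_fset_condE; exact: le_trans (ler_norm _) (bnd _).
rewrite (eq_bigr (fun i => - b i)) => [|i]; last by rewrite -ltNge => /ltW /ler0_norm.
rewrite sumrN big_fset_condE; apply: le_trans (bnd _).
by rewrite -[leRHS]normrN; exact: ler_norm.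
Qed.

End UnconditionalSums.

Section LineContinuity.
Variables (R : realType) (m : nat).

(** Along the line through a with direction w the term of multi-index al is
    multiplied by tau^|al|, hence by at most |tau| unless al = 0. Absolute
    summability at one point of the line thus bounds G - G(a) by a constant
    times |tau|. Continuity along a line lets a polynomial relation for G pass to the
    limit. *)
Lemma analytic_line_continuous (G : 'rV[R]_m -> R) (a w : 'rV[R]_m) :
  analytic_at G a -> {for (0 : R), continuous (fun s : R => G (a + s *: w))}.
Proof.
move=> [c [r [r0 H]]].
pose W := 1 + \sum_i `|w 0 i|.
have W0 : 0 < W by rewrite ltr_pwDl // sumr_ge0.
(* a time at which the line is still inside of the polydisc *)
pose s0 := r / W.
have s00 : 0 < s0 by rewrite divr_gt0.
have ws i : `|s0 * w 0 i| < r.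
  rewrite normrM gtr0_norm // /s0 mulrAC ltr_pdivrMr // ltr_pM2l //.
  by rewrite /W (bigD1 i) //= addrCA ltrDl ltr_pwDl // sumr_ge0.
pose b (al : {ffun 'I_m -> nat}) := c al * \prod_i (s0 * w 0 i) ^+ al i.
pose deg (al : {ffun 'I_m -> nat}) := (\sum_i al i)%N.
have Hw (tau : R) : `|tau| <= 1 ->
    partial_sum (fun al => tau ^+ deg al * b al) @ totally --> G (a + (tau * s0) *: w).
  move=> t1; have := H ((tau * s0) *: w).
  have -> : (fun al : {ffun 'I_m -> nat} => c al * \prod_i ((tau * s0) *: w) 0 i ^+ al i) =
      (fun al => tau ^+ deg al * b al).
    apply/funext => al; rewrite /b [RHS]mulrCA; congr (_ * _).
    rewrite /deg expr_sum -big_split /=; apply: eq_bigr => i _.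
    by rewrite mxE -mulrA exprMn.
  apply=> i; rewrite mxE -mulrA normrM.
  by apply: le_lt_trans (ws i); rewrite ler_piMl.
have b1 : partial_sum b @ totally --> G (a + s0 *: w).
  have := Hw 1; rewrite normr1 lexx mul1r => /(_ isT).
  have -> // : (fun al => 1 ^+ deg al * b al) = b.
  by apply/funext => al; rewrite expr1n mul1r.
have [M hM] := unconditional_sum_abs b1.
pose al0 : {ffun 'I_m -> nat} := [ffun=> 0%N].
have deg0 al : al != al0 -> (0 < deg al)%N.
  move=> al_neq; rewrite lt0n; apply: contra al_neq => /eqP d0.
  apply/eqP/ffunP => i; rewrite ffunE; apply/eqP.
  by move/eqP: d0; rewrite /deg sum_nat_eq0 => /forallP /(_ i).
have key (tau : R) : `|tau| <= 1 -> `|G (a + (tau * s0) *: w) - b al0| <= M * `|tau|.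
  move=> t1; apply/ler_addgt0Pr => e e0.
  have /(@cvgrPdist_lt _ _ _ _ totally_filter) /(_ e e0)[A0 _ hA] := Hw tau t1.
  have /hA /= : (A0 `<=` (al0 |` A0))%fset by exact: fsubsetUr.
  rewrite partial_sumE; set A := (al0 |` A0)%fset => h.
  have al0A : al0 \in A by rewrite !inE eqxx.
  move: h; rewrite (big_fsetD1 al0) //= {1}/deg big1 => [|i _]; last by rewrite ffunE.
  rewrite expr0 mul1r; set T := \sum_(_ <- _) _ => h.
  have TM : `|T| <= M * `|tau|.
    apply: le_trans (ler_norm_sum _ _ _) _.
    apply: (@le_trans _ _ (\sum_(al <- enum_fset (A `\ al0)%fset) `|b al| * `|tau|)).
      rewrite !big_seq; apply: ler_sum => al; rewrite !inE => /andP[/deg0 dal _].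
      rewrite normrM normrX mulrC ler_wpM2l //.
      by rewrite -(prednK dal) exprS ler_piMr // exprn_ile1.
    by rewrite -mulr_suml ler_wpM2r.
  have -> : G (a + (tau * s0) *: w) - b al0 = T + (G (a + (tau * s0) *: w) - (b al0 + T)).
    by ring.
  by apply: le_trans (ler_normD _ _) (lerD TM (ltW h)).
have G0 : G (a + (0 : R) *: w) = b al0.
  have := key 0; rewrite normr0 ler01 mul0r mulr0 normr_le0 subr_eq0 => /(_ isT) /eqP.
  exact.
apply/cvgrPdist_lt => e e0; rewrite G0.
have M0 : 0 <= M by apply: le_trans (hM fset0%fset); rewrite sumr_ge0.
pose d := Num.min s0 (e * s0 / (M + 1)).
have M1 : 0 < M + 1 by rewrite ltr_wpDl.
have d0 : 0 < d by rewrite lt_min s00 divr_gt0 // mulr_gt0.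
apply/nbhs_ballP; exists d => //= s; rewrite /ball /= sub0r normrN lt_min => /andP[sd1 sd2].
have sE : s = (s / s0) * s0 by rewrite divfK // gt_eqF.
have t1 : `|s / s0| <= 1 by rewrite normrM normfV (gtr0_norm s00) ler_pdivrMr // mul1r ltW.
rewrite distrC sE; apply: le_lt_trans (key _ t1) _.
rewrite normrM normfV (gtr0_norm s00) mulrA ltr_pdivrMr //.
apply: (@le_lt_trans _ _ ((M + 1) * `|s|)); first by rewrite ler_wpM2r // lerDl.
by move: sd2; rewrite ltr_pdivlMr // mulrC.
Qed.

End LineContinuity.

(** * Non-zeros of polynomials and restriction of polynomial relations to planes *)

Section Polynomials.

Lemma mmap_comp n (k : nzRingType) (S S' : nzRingType) (g : {rmorphism S -> S'})
    (f : k -> S) (h : 'I_n -> S) (P : mpoly.mpoly n k) :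
  g (mpoly.mmap f h P) = mpoly.mmap (fun x => g (f x)) (fun i => g (h i)) P.
Proof.
rewrite /mpoly.mmap rmorph_sum; apply: eq_bigr => m _ /=.
rewrite rmorphM /mpoly.mmap1 rmorph_prod; congr (_ * _); apply: eq_bigr => i _.
by rewrite rmorphXn.
Qed.

Lemma eq_mmap n (k S : nzRingType) (f f' : k -> S) (h h' : 'I_n -> S) (P : mpoly.mpoly n k) :
  f =1 f' -> h =1 h' -> mpoly.mmap f h P = mpoly.mmap f' h' P.
Proof.
move=> ff hh; rewrite /mpoly.mmap; apply: eq_bigr => m _; rewrite ff; congr (_ * _).
by apply: eq_bigr => i _; rewrite hh.
Qed.

Lemma poly_nonroot (k : idomainType) (p : {poly k}) (f : nat -> k) :
  injective f -> p != 0 -> exists n, p.[f n] != 0.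
Proof.
move=> fI p0; apply/not_existsP => H.
have := @max_poly_roots k p (map f (iota 0 (size p))) p0.
rewrite map_inj_uniq // iota_uniq size_map size_iota ltnn.
suff -> : all (root p) [seq f i | i <- iota 0 (size p)] by move=> /(_ isT isT).
by apply/allP => _ /mapP[n _ ->]; rewrite rootE; move/negP: (H n); rewrite negbK.
Qed.

(** Uniqueness of the expansion in base d. *)
Lemma digits_inj (d n : nat) (a b : 'I_n -> nat) :
  (forall i, a i < d)%N -> (forall i, b i < d)%N ->
  (\sum_i a i * d ^ i = \sum_i b i * d ^ i)%N -> a =1 b.
Proof.
elim: n a b => [|n IH] a b ad bd; first by move=> _ [].
have step (c : 'I_n.+1 -> nat) : (\sum_i c i * d ^ i =
    (\sum_(i < n) c (lift ord0 i) * d ^ i) * d + c ord0)%N.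
  rewrite big_ord_recl muln1 addnC big_distrl /=; congr (_ + _)%N.
  by apply: eq_bigr => i _; rewrite -mulnA -expnSr.
rewrite !step => E.
have E0 : a ord0 = b ord0.
  by have := congr1 (modn^~ d) E; rewrite !modnMDl !modn_small.
have d0 : (0 < d)%N by apply: leq_ltn_trans (ad ord0).
have E1 : (\sum_(i < n) a (lift ord0 i) * d ^ i = \sum_(i < n) b (lift ord0 i) * d ^ i)%N.
  by have := congr1 (divn^~ d) E; rewrite !divnMDl // !divn_small // !addn0.
move=> i; case: (unliftP ord0 i) => [j|] -> //.
exact: (IH (fun j => a (lift ord0 j)) (fun j => b (lift ord0 j))).
Qed.

(** Kronecker substitution: replacing the i-th variable by 'X^(d^i), with d larger
    than all exponents, sends distinct monomials to distinct powers of 'X, so a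
    non-zero polynomial stays non-zero and has a non-root among the natural
    numbers. *)
Lemma mpoly_nonroot n (k : numFieldType) (P : mpoly.mpoly n k) : P != 0 ->
  exists v, mpoly.meval v P != 0.
Proof.
move=> P0; pose d := mpoly.msize P.
pose code (m : mpoly.multinom n) := (\sum_(i < n) m i * d ^ i)%N.
pose Q := mpoly.mmap (@polyC k) (fun i => 'X^(d ^ i)) P.
have QE : Q = \sum_(m <- mpoly.msupp P) (mpoly.mcoeff m P)%:P * 'X^(code m).
  rewrite /Q /mpoly.mmap; apply: eq_bigr => m _; congr (_ * _).
  rewrite /mpoly.mmap1 /code expr_sum; apply: eq_bigr => i _.
  by rewrite -exprM mulnC.
have md (m : mpoly.multinom n) i : m \in mpoly.msupp P -> (m i < d)%N.
  move=> /mpoly.msize_mdeg_lt; apply: leq_ltn_trans.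
  by rewrite mpoly.mdegE (bigD1 i) //= leq_addr.
have Q0 : Q != 0.
  apply/eqP => Qz.
  have m0P := mpoly.mlead_supp P0; set m0 := mpoly.mlead P in m0P.
  have : Q`_(code m0) = mpoly.mcoeff m0 P.
    rewrite QE coef_sum (bigD1_seq m0) //= ?mpoly.msupp_uniq //.
    rewrite coefCM coefXn eqxx mulr1 big_seq_cond big1 ?addr0 // => m /andP[mP mm0].
    rewrite coefCM coefXn; case: eqP => [E|_]; last by rewrite mulr0.
    case/eqP: mm0; apply/mpoly.mnmP => i.
    apply: (@digits_inj d n (fun i => m i) (fun i => m0 i) _ _ _ i) => [j|j|].
    - exact: md.
    - exact: md.
    - exact: esym.
  rewrite Qz coef0 => /esym /eqP; rewrite mpoly.mcoeff_eq0.
  by rewrite m0P.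
have nI : injective (fun i : nat => i%:R : k).
  by move=> i j /eqP; rewrite eqr_nat => /eqP.
have [s hs] := poly_nonroot nI Q0.
exists (fun i => s%:R ^+ (d ^ i)).
have -> : mpoly.meval (fun i => s%:R ^+ (d ^ i)) P = Q.[s%:R] => //.
rewrite -[RHS]/(horner_eval s%:R Q) /Q mmap_comp /mpoly.meval.
by apply: eq_mmap => [x|i] /=; rewrite /horner_eval ?hornerC ?hornerXn.
Qed.

End Polynomials.

Section Slice.
Variables (R : realType) (m : nat).

(** The points of the three-dimensional space where the relations between x, y and
    a value t live. *)
Definition pt3 (S : Type) (x y t : S) (i : 'I_3) : S := nth x [:: x; y; t] i.

Lemma pt3_map (S S' : Type) (g : S -> S') (x y t : S) i :
  g (pt3 x y t i) = pt3 (g x) (g y) (g t) i.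
Proof. by rewrite /pt3; case: i => [[|[|[|]]]]. Qed.

Lemma continuous_mmap (T : topologicalType) (K : numFieldType) n (k : nzRingType) (x : T)
    (f : k -> K) (h : 'I_n -> T -> K) (P : mpoly.mpoly n k) :
  (forall i, {for x, continuous (h i)}) ->
  {for x, continuous (fun s => mpoly.mmap f (fun i => h i s) P : K)}.
Proof.
move=> ch; apply: continuous_sumK => mo; apply: continuousMC.
  exact: continuous_cstC.
apply: continuous_prodK => i; exact: continuousXK.
Qed.

Lemma continuous_horner2 (T : topologicalType) (K : numFieldType) (B : nzRingType)
    (Q : {poly B}) (x : T) (e : T -> {rmorphism B -> K}) (s : T -> K) :
  (forall b, {for x, continuous (fun t => e t b : K)}) -> {for x, continuous s} ->
  {for x, continuous (fun t => (map_poly (e t) Q).[s t] : K)}.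
Proof.
move=> ce cs.
have -> : (fun t => (map_poly (e t) Q).[s t]) =
    (fun t => \sum_(0 <= i < size Q) e t Q`_i * s t ^+ i).
  apply/funext => t; rewrite (@horner_coef_wide _ (size Q)) ?size_poly //.
  rewrite big_mkord.
  by apply: eq_bigr => i _; rewrite coef_map.
apply: continuous_sumK => i; apply: continuousMC; first exact: ce.
exact: continuousXK.
Qed.

Section Eval2.
Variables (B K : comNzRingType) (e : {rmorphism B -> K}) (s : K).

(** Evaluation of a polynomial over B at s after its coefficients have been
    evaluated by e; it is applied to polynomials in an extra variable over the
    ring of polynomials in x, y and t. *)
Definition eval2 (p : {poly B}) : K := horner_eval s (map_poly e p).

Lemma eval2C c : eval2 c%:P = e c.
Proof. by rewrite /eval2 map_polyC /horner_eval hornerC. Qed.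

Lemma eval2_affine c d : eval2 (c%:P + d%:P * 'X) = e c + e d * s.
Proof.
by rewrite /eval2 rmorphD rmorphM /= !map_polyC map_polyX /horner_eval !hornerE.
Qed.

Lemma eval2_mulXn q n : eval2 (q * 'X^n) = eval2 q * s ^+ n.
Proof. by rewrite /eval2 rmorphM rmorphXn /= map_polyX /horner_eval !hornerE. Qed.

Lemma eval2_mmap n (k : nzRingType) (f : k -> {poly B}) (h : 'I_n -> {poly B})
    (P : mpoly.mpoly n k) :
  eval2 (mpoly.mmap f h P) = mpoly.mmap (fun x => eval2 (f x)) (fun i => eval2 (h i)) P.
Proof. by rewrite /eval2 (mmap_comp (map_poly e)) (mmap_comp (horner_eval s)). Qed.

End Eval2.

(** Restricting P to the plane spanned by u1 and u2 may give the zero polynomial.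
    So the plane is moved by s w, where w comes from a non-root of P: the
    restriction becomes a non-zero polynomial in s over R[x, y, t], of the form
    s^k Q with Q non-zero at s = 0. For s different from 0 the relation holds
    with Q in place of s^k Q, and it passes to the limit s = 0 because G is
    continuous along lines. *)
Lemma slice_polynomial (P : mpoly.mpoly m.+1 R) (V : set 'rV[R]_m) (G : 'rV[R]_m -> R)
    (u1 u2 : 'rV[R]_m) : P != 0 -> open V ->
  (forall x, V x -> analytic_at G x) ->
  (forall x, V x -> mpoly.meval (graph_point x (G x)) P = 0) ->
  exists2 P0 : mpoly.mpoly 3 R, P0 != 0 & forall x y : R,
    V (x *: u1 + y *: u2) -> mpoly.meval (pt3 x y (G (x *: u1 + y *: u2))) P0 = 0.
Proof.
move=> P0 oV aG vP.
have [v0 hv0] := mpoly_nonroot P0.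
pose w : 'rV[R]_m := \row_j v0 (lift ord_max j).
pose B : idomainType := mpoly.mpoly 3 R.
pose X0 : B := mpoly.mpolyX R (mpoly.mnm1 (inord 0)).
pose X1 : B := mpoly.mpolyX R (mpoly.mnm1 (inord 1)).
pose X2 : B := mpoly.mpolyX R (mpoly.mnm1 (inord 2)).
pose cB (c : R) : B := mpoly.mpolyC 3 c.
pose h (i : 'I_m.+1) : {poly B} :=
  if unlift ord_max i is Some j
  then (cB (u1 0 j) * X0 + cB (u2 0 j) * X1)%:P + (cB (w 0 j))%:P * 'X
  else X2%:P.
pose PP := mpoly.mmap (fun c => (cB c)%:P) h P.
pose ev (x y t : R) : {rmorphism B -> R} := mpoly.meval (pt3 x y t).
have evE x y t s : eval2 (ev x y t) s PP =
    mpoly.meval (graph_point (x *: u1 + y *: u2 + s *: w) t) P.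
  rewrite /PP eval2_mmap; apply: eq_mmap => [c|i].
    by rewrite eval2C; exact: mpoly.mevalC.
  rewrite /graph_point /h; case: (unlift ord_max i) => [j|].
    rewrite eval2_affine /ev /= mpoly.mevalD !mpoly.mevalM /cB /X0 /X1 !mpoly.mevalC !mpoly.mevalXU.
    by rewrite !mxE /pt3 !inordK //= mulrC [_ * y]mulrC [_ * s]mulrC.
  by rewrite eval2C /ev /= /X2 mpoly.mevalXU /pt3 inordK.
have PP0 : PP != 0.
  apply: contra hv0 => /eqP PPz.
  have := evE 0 0 (v0 ord_max) 1; rewrite PPz /eval2 rmorph0 /horner_eval horner0 => E.
  suff -> : mpoly.meval v0 P = mpoly.meval
      (graph_point ((0 : R) *: u1 + (0 : R) *: u2 + (1 : R) *: w) (v0 ord_max)) P by rewrite -E.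
  rewrite /mpoly.meval; apply: eq_mmap => // i.
  rewrite /graph_point; case: unliftP => [j|] -> //.
  by rewrite !mxE !mul0r mul1r !add0r.
have [k [Q]] := multiplicity_XsubC PP 0; rewrite PP0 subr0 /= => Q0 PPE.
exists Q.[0]; first by rewrite -rootE.
move=> x y Vxy; set b := x *: u1 + y *: u2 in Vxy *.
pose psi s := eval2 (ev x y (G (b + s *: w))) s Q.
have cpsi : {for (0 : R), continuous psi}.
  apply: continuous_horner2; last exact: cvg_id.
  move=> c; apply: (@continuous_mmap R R 3 R 0 idfun (fun i s => pt3 x y (G (b + s *: w)) i)).
  move=> [[|[|[|//]]]] ? ; rewrite /pt3 /=; try exact: continuous_cstC.
  exact: analytic_line_continuous (aG _ Vxy).
have cl : {for (0 : R), continuous (fun s : R => b + s *: w)}.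
  apply: cvgD; first exact: cvg_cst.
  by apply: cvgZl; exact: cvg_id.
have nV : nbhs (0 : R) [set s : R | V (b + s *: w)].
  apply: cl; rewrite scale0r addr0; exact: open_nbhs_nbhs.
have psi0 : \forall s \near (0 : R), s != 0 -> psi s = 0.
  near=> s; move=> s0.
  have Vs : V (b + s *: w) by near: s.
  have := evE x y (G (b + s *: w)) s; rewrite -/b vP // PPE eval2_mulXn => /eqP.
  by rewrite mulf_eq0 expf_eq0 (negPf s0) andbF orbF => /eqP.
have : psi 0 = 0.
  apply/eqP; rewrite -normr_le0; apply/ler_addgt0Pr => e e0; rewrite add0r.
  have /cvgrPdist_lt /(_ e e0) hc := cpsi.
  have /nbhs_ballP[d /= d0 hd] : \forall s \near (0 : R), `|psi 0 - psi s| < e /\ (s != 0 -> psi s = 0).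
    by apply: filterS2 hc psi0 => s.
  have [] := hd (d / 2).
    by rewrite /ball /= sub0r normrN gtr0_norm ?divr_gt0 // ltr_pdivrMr // mulr_natr mulr2n ltrDl.
  have d2 : d / 2 != 0 by rewrite gt_eqF // divr_gt0.
  by move=> + /(_ d2) psid; rewrite psid subr0 => /ltW.
rewrite /psi scale0r addr0 => <-; rewrite /eval2 /horner_eval.
have := horner_map (ev x y (G b)) Q 0; rewrite rmorph0.
exact: esym.
Unshelve. all: by end_near. Qed.

End Slice.

(** * Holomorphic functions with an algebraic real part *)

Section Algebraic.
Variable R : realType.
Local Notation C := (R[i] : numFieldType).

Lemma hol_mmap r n (P : mpoly.mpoly n R) (h : 'I_n -> C -> C) :
  (forall i, hol r (h i)) ->
  hol r (fun z => mpoly.mmap (real_complex R) (fun i => h i z) P).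
Proof.
move=> hh; apply: hol_sum => m; apply: holM; first exact: hol_cst.
by apply: hol_prod => i; exact: holX.
Qed.

(** The relation between z and g z is a polynomial in the value with coefficients
    polynomial in z, the form in which resultants apply. *)
Definition algebraic_near (g : C -> C) (z0 : R[i]) :=
  exists2 p : {poly {poly R[i]}}, p != 0 &
  exists2 d : R, 0 < d & forall z, nc (z - z0) < d -> p.[(g z)%:P].[z] = 0.

Lemma mmap_pt3 (k S S' : nzRingType) (e : {rmorphism S -> S'}) (f : k -> S) (x y t : S)
    (P : mpoly.mpoly 3 k) :
  e (mpoly.mmap f (pt3 x y t) P) =
  mpoly.mmap (fun c => e (f c)) (pt3 (e x) (e y) (e t)) P.
Proof. by rewrite mmap_comp; apply: eq_mmap => [//|i]; exact: pt3_map. Qed.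

Section Complexify.
Variables (P : mpoly.mpoly 3 R) (f : C -> C) (x0 y0 r : R).
Hypotheses (r0 : 0 < r) (hf : hol (r + r) f).
Hypothesis fP : forall x y : R, `|x| + `|y| < r + r ->
  mpoly.meval (pt3 (x0 + x) (y0 + y) (Re (f (x +i* y)))) P = 0.

Let fs (w : C) : C := conjc (f (conjc w)).

(** For real xi and eta this is the relation P between the coordinates and the real
    part of f at xi + i eta, the real part being written as the half sum of f and
    of its conjugate. In this form it makes sense, and is holomorphic in each
    variable, for complex xi and eta; the factor 1 gives the arguments the shape
    a z + b of an affine substitution. *)
Definition Phi (xi eta : R[i]) : R[i] :=
  mpoly.mmap (real_complex R) (pt3 (x0%:C + xi) (y0%:C + eta)
    ((f (1 * xi + 'i * eta) + fs (1 * xi - 'i * eta)) / 2)) P.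

Lemma Phi_real (x y : R) : `|x| + `|y| < r + r -> Phi x%:C y%:C = 0.
Proof.
move=> xy; rewrite /Phi /fs.
have -> : 1 * x%:C + 'i * y%:C = x +i* y :> R[i].
  by apply/eqP; rewrite eq_complex /=; apply/andP; split; apply/eqP; ring.
have -> : conjc (1 * x%:C - 'i * y%:C) = x +i* y :> R[i].
  by apply/eqP; rewrite eq_complex /=; apply/andP; split; apply/eqP; ring.
rewrite -ReJ_add -!rmorphD /=.
have := congr1 (real_complex R) (fP xy); rewrite rmorph0 => <-.
by rewrite /mpoly.meval mmap_pt3.
Qed.

Lemma nc_i : nc 'i = 1 :> R.
Proof. by rewrite /nc /= expr0n expr1n add0r sqrtr1. Qed.

Lemma nc2 : nc 2 = 2 :> R.
Proof.
have -> : 2 = (2 : R)%:C :> R[i] by rewrite (rmorph_nat (real_complex R) 2).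
by rewrite nc_real normr_nat.
Qed.

Lemma hol_Phi1 (eta : R[i]) : nc eta < r -> hol r (fun xi : C => Phi xi eta).
Proof.
move=> er.
have h1 : hol r (fun xi : C => f (1 * xi + 'i * eta)).
  apply: (hol_affine hf) => z zr; apply: le_lt_trans (ncD _ _) _.
  by rewrite !ncM nc1 nc_i !mul1r ltrD.
have h2 : hol r (fun xi : C => fs (1 * xi - 'i * eta)).
  apply: (hol_affine (hol_conj hf)) => z zr; apply: le_lt_trans (ncB _ _) _.
  by rewrite !ncM nc1 nc_i !mul1r ltrD.
apply: (@hol_mmap r 3 P (fun i xi => pt3 (x0%:C + xi) (y0%:C + eta)
    ((f (1 * xi + 'i * eta) + fs (1 * xi - 'i * eta)) / 2) i)).
move=> [[|[|[|//]]]] ?; rewrite /pt3 /=.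
- by apply: holD; [exact: hol_cst|exact: hol_id].
- exact: hol_cst.
- by apply: holM; [exact: holD h1 h2|exact: hol_cst].
Qed.

Lemma hol_Phi2 (xi : R[i]) : nc xi < r -> hol r (fun eta : C => Phi xi eta).
Proof.
move=> xr.
have h1 : hol r (fun eta : C => f (1 * xi + 'i * eta)).
  have -> : (fun eta : C => f (1 * xi + 'i * eta)) = (fun eta => f ('i * eta + xi)).
    by apply/funext => eta; rewrite mul1r addrC.
  apply: (hol_affine hf) => z zr; apply: le_lt_trans (ncD _ _) _.
  by rewrite !ncM nc_i !mul1r ltrD.
have h2 : hol r (fun eta : C => fs (1 * xi - 'i * eta)).
  have -> : (fun eta : C => fs (1 * xi - 'i * eta)) = (fun eta => fs (- 'i * eta + xi)).
    by apply/funext => eta; rewrite mul1r mulNr addrC.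
  apply: (hol_affine (hol_conj hf)) => z zr; apply: le_lt_trans (ncD _ _) _.
  by rewrite !ncM ncN nc_i !mul1r ltrD.
apply: (@hol_mmap r 3 P (fun i eta => pt3 (x0%:C + xi) (y0%:C + eta)
    ((f (1 * xi + 'i * eta) + fs (1 * xi - 'i * eta)) / 2) i)).
move=> [[|[|[|//]]]] ?; rewrite /pt3 /=.
- exact: hol_cst.
- by apply: holD; [exact: hol_cst|exact: hol_id].
- by apply: holM; [exact: holD h1 h2|exact: hol_cst].
Qed.

(** The identity theorem extends the relation from real to complex values, one
    variable at a time. *)
Lemma Phi0 (xi eta : R[i]) : nc xi < r -> nc eta < r -> Phi xi eta = 0.
Proof.
move=> xr; apply: (identity_theorem (hol_Phi2 xr)) => y yr.
have yr' : nc y%:C < r by rewrite nc_real.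
move: xi xr; apply: (identity_theorem (hol_Phi1 yr')) => x xr.
by apply: Phi_real; rewrite ltrD.
Qed.

(** With z = xi + i eta and w = xi - i eta as independent variables, the relation
    involves f at z and the conjugate function at w separately. *)
Lemma polarized (z w : R[i]) : nc z < r -> nc w < r ->
  mpoly.mmap (real_complex R) (pt3 (x0%:C + (z + w) / 2) (y0%:C + (z - w) / (2 * 'i))
    ((f z + fs w) / 2)) P = 0.
Proof.
move=> zr wr; have i0 : 'i != 0 :> R[i] by rewrite eq_complex /= oner_eq0 andbF.
have := @Phi0 ((z + w) / 2) ((z - w) / (2 * 'i)).
rewrite /Phi.
have -> : 1 * ((z + w) / 2) + 'i * ((z - w) / (2 * 'i)) = z by field; rewrite i0.
have -> : 1 * ((z + w) / 2) - 'i * ((z - w) / (2 * 'i)) = w by field; rewrite i0.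
apply; rewrite ncM ncV ?ncM ?nc_i ?mulr1 nc2 ltr_pdivrMr // mulr_natr mulr2n.
  by apply: le_lt_trans (ncD _ _) _; rewrite ltrD.
by apply: le_lt_trans (ncB _ _) _; rewrite ltrD.
Qed.

Hypothesis P0 : P != 0.

(** In the polarized relation fix w at a value w0: the conjugate function
    contributes a constant, and what remains is a polynomial relation between z
    and f z. It is non-trivial for all but finitely many w0, since P is non-zero
    and the change of variables is invertible. *)
Lemma algebraic_of_real_part (kappa : R[i]) : kappa != 0 ->
  algebraic_near (fun z => kappa * f (z - (x0 +i* y0))) (x0 +i* y0).
Proof.
move=> k0; set z0 := x0 +i* y0.
have i0 : 'i != 0 :> R[i] by rewrite eq_complex /= oner_eq0 andbF.
have [v hv] := mpoly_nonroot P0.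
pose a := v (inord 0); pose b := v (inord 1); pose c := v (inord 2).
have vE : v =1 pt3 a b c.
  move=> [[|[|[|//]]] Hi]; rewrite /pt3 /=; congr v; apply: val_inj; rewrite /= inordK //.
pose z1 : R[i] := (a - x0) +i* (b - y0).
pose w1 : R[i] := (a - x0) -i* (b - y0).
(* the relation as a polynomial in w, at z = z1 and at the value c: it does not
   vanish at w1, where it equals P at its non-root (a, b, c) *)
pose W : {poly R[i]} := mpoly.mmap (fun t : R => (t%:C)%:P)
  (pt3 ((x0%:C + z1 / 2)%:P + (2^-1)%:P * 'X)
       ((y0%:C + z1 / (2 * 'i))%:P - ((2 * 'i)^-1)%:P * 'X) (c%:C)%:P) P.
have WE w : W.[w] = mpoly.mmap (real_complex R) (pt3 (x0%:C + (z1 + w) / 2)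
    (y0%:C + (z1 - w) / (2 * 'i)) c%:C) P.
  rewrite -[LHS]/(horner_eval w W) /W (mmap_pt3 (horner_eval w)).
  apply: eq_mmap => [t|i]; first exact: hornerC.
  rewrite /= /horner_eval !hornerE; congr (pt3 _ _ _ i); first by field.
  by field; rewrite i0.
have W0 : W != 0.
  apply: contra hv => /eqP W0; apply/eqP/(complexI (R := R)).
  rewrite rmorph0 -[RHS](horner0 w1) -W0 WE /mpoly.meval.
  rewrite (eq_mmap (f' := idfun) (h' := pt3 a b c) P) // (mmap_pt3 (real_complex R)).
  apply: eq_mmap => // i; congr (pt3 _ _ _ i).
    by apply/eqP; rewrite eq_complex /=; apply/andP; split; apply/eqP; field.
  have -> : z1 - w1 = (b - y0)%:C * (2 * 'i).
    by apply/eqP; rewrite eq_complex /=; apply/andP; split; apply/eqP; ring.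
  by rewrite mulfK ?mulf_neq0 ?pnatr_eq0 // -rmorphD addrC subrK.
(* infinitely many candidates for w0 inside of the disc; the shift by 2 makes the
   modulus strictly smaller than r *)
pose g n : R[i] := (r / n.+2%:R)%:C.
have gI : injective g.
  move=> n m /(complexI (R := R)) /(mulfI (lt0r_neq0 r0)) /invr_inj /eqP.
  by rewrite eqr_nat => /eqP [].
have [n hn] := poly_nonroot gI W0.
set w0 := g n in hn.
have w0r : nc w0 < r.
  rewrite /w0 /g nc_real ger0_norm ?divr_ge0 ?ltW // ltr_pdivrMr // ltr_pMr //.
  by rewrite ltr1n.
(* the variable of the outer polynomial is kappa times the value of f at z - z0,
   that of the inner ones is z *)
pose p : {poly {poly R[i]}} := mpoly.mmap (fun t : R => (t%:C)%:P%:P)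
  (pt3 ((x0%:C + (w0 - z0) / 2)%:P + (2^-1)%:P * 'X)%:P
       ((y0%:C - (w0 + z0) / (2 * 'i))%:P + ((2 * 'i)^-1)%:P * 'X)%:P
       ((fs w0 / 2)%:P%:P + ((2 * kappa)^-1)%:P%:P * 'X)) P.
have pE z t : p.[t%:P].[z] = mpoly.mmap (real_complex R)
    (pt3 (x0%:C + (z - z0 + w0) / 2) (y0%:C + (z - z0 - w0) / (2 * 'i))
         (fs w0 / 2 + t / (2 * kappa))) P.
  rewrite -[LHS]/(horner_eval z (horner_eval t%:P p)) /p.
  rewrite (mmap_pt3 (horner_eval t%:P)) (mmap_pt3 (horner_eval z)).
  apply: eq_mmap => [s|i]; first by rewrite /= /horner_eval !hornerC.
  rewrite /= /horner_eval !hornerE; congr (pt3 _ _ _ i); first by field.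
    rewrite -addrA; congr (_ + _).
    rewrite [X in _ + X]mulrC -mulNr -mulrDl; congr (_ * _).
    by rewrite opprD addrC addrA addrAC.
  by congr (_ + _); exact: mulrC.
exists p.
  apply: contra hn => /eqP p0; apply/eqP; rewrite WE.
  (* the point over z1 at which the value of the relation is W.[w0] *)
  have := pE (z1 + z0) ((c%:C - fs w0 / 2) * (2 * kappa)).
  rewrite p0 !horner0 addrK => ->; apply: eq_mmap => // i; congr (pt3 _ _ _ i).
  rewrite mulfK; first by rewrite addrC subrK.
  by rewrite mulf_neq0 // pnatr_eq0.
exists r => // z zr; rewrite pE -[RHS](polarized zr w0r).
apply: eq_mmap => // i; congr (pt3 _ _ _ i).
by field; rewrite k0.
Qed.

End Complexify.

(** A resultant of the two annihilating polynomials eliminates one of the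
    values. *)
Lemma algebraic_near_sub (g1 g2 : C -> C) z0 : algebraic_near g1 z0 -> algebraic_near g2 z0 ->
  algebraic_near (fun z => g1 z - g2 z) z0.
Proof.
move=> [p p0 [d1 d10 h1]] [q q0 [d2 d20 h2]].
(* the elimination lemma needs polynomials of positive degree *)
have pX0 : p * 'X != 0 by rewrite mulf_neq0 // polyX_eq0.
have qX0 : q * 'X != 0 by rewrite mulf_neq0 // polyX_eq0.
exists (sub_annihilant (p * 'X) (q * 'X)); first exact: sub_annihilant_neq0.
exists (Num.min d1 d2); first by rewrite lt_min d10.
move=> z; rewrite lt_min => /andP[z1 z2].
have sX (s : {poly {poly R[i]}}) : s != 0 -> (1 < size (s * 'X)%R)%N.
  by move=> s0; rewrite size_mulX // ltnS size_poly_gt0.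
have [uv _ E] := sub_annihilant_in_ideal (sX _ p0) (sX _ q0).
rewrite (E (g2 z)%:P) -polyCD [g2 z + _]addrC subrK hornerD !hornerM.
by rewrite h1 // h2 // !(mul0r, mulr0) addr0.
Qed.

(** Translates a polynomial in one variable over polynomials in another into a
    polynomial in two variables. *)
Lemma algebraic_mpoly (g : C -> C) z0 : algebraic_near g z0 ->
  exists2 d : R, 0 < d & exists2 P : mpoly.mpoly 2 C, P != 0 &
  forall x : 'rV[C]_1, nc (x 0 0 - z0) < d ->
    mpoly.meval (graph_point x (g (x 0 0))) P = 0.
Proof.
move=> [p p0 [d d0 hp]]; exists d => //.
pose X0 : mpoly.mpoly 2 C := mpoly.mpolyX C (mpoly.mnm1 (inord 0)).
pose X1 : mpoly.mpoly 2 C := mpoly.mpolyX C (mpoly.mnm1 (inord 1)).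
pose io : {poly C} -> mpoly.mpoly 2 C := horner_eval X0 \o map_poly (@mpoly.mpolyC 2 C).
pose P := horner_eval X1 (map_poly io p).
have PE v : mpoly.meval v P = p.[(v (inord 1))%:P].[v (inord 0)].
  rewrite /P /horner_eval -horner_map /= -map_poly_comp /=.
  rewrite -[RHS]/(horner_eval (v (inord 0)) _) -horner_map /=.
  rewrite /horner_eval hornerC mpoly.mevalXU; congr (_.[_]).
  apply: eq_map_poly => q /=; rewrite /io /horner_eval /= -horner_map /= -map_poly_comp /=.
  rewrite mpoly.mevalXU; congr (_.[_]).
  rewrite (@eq_map_poly _ _ _ idfun) => [|c]; last exact: mpoly.mevalC.
  exact: map_poly_id.
have nI : injective (fun i : nat => i%:R : C).
  by move=> i j /eqP; rewrite eqr_nat => /eqP.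
have nPI : injective (fun i : nat => (i%:R : C)%:P).
  by move=> i j /polyC_inj /nI.
exists P.
  have [n hn] := poly_nonroot nPI p0.
  have [m hm] := poly_nonroot nI hn.
  pose v (i : 'I_2) : C := if i == inord 0 then m%:R else n%:R.
  apply: contra hm => /eqP Pz.
  have := PE v; rewrite Pz mpoly.meval0 /v eqxx.
  have -> : (inord 1 == inord 0 :> 'I_2) = false by apply/eqP => /(congr1 val); rewrite /= !inordK.
  by move=> <-.
move=> x xd; rewrite PE -[RHS](hp _ xd).
have -> : graph_point x (g (x 0 0)) (inord 1) = g (x 0 0).
  rewrite /graph_point; case: unliftP => [j /(congr1 val)|//].
  by rewrite /= inordK // /bump; case: j => [[|//]].
have -> : graph_point x (g (x 0 0)) (inord 0) = x 0 0.
  rewrite /graph_point; case: unliftP => [j _|/(congr1 val)]; first by rewrite (ord1 j).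
  by rewrite /= inordK.
by [].
Qed.

Lemma complex_nash_local (D : set C) (g : C -> C) : open D ->
  (forall z0, D z0 -> (exists2 r : R, 0 < r & hol r (fun z => g (z + z0))) /\ algebraic_near g z0) ->
  complex_nash_on D g.
Proof.
move=> oD hg a /= Da; set z0 := a 0 0 in Da.
have [[r r0 hr] /algebraic_mpoly[d d0 [P P0 hP]]] := hg _ Da.
have /(nbhsCP z0)[e e0 he] : nbhs (z0 : C) D by exact: open_nbhs_nbhs.
pose m := Num.min r (Num.min d e).
have m0 : 0 < m by rewrite !lt_min r0 d0.
exists [set x : 'rV[C]_1 | nc (x 0 0 - z0) < m]; split.
- rewrite [X in open X](_ : _ = (fun x : 'rV[C]_1 => x 0 0) @^-1` (ball (z0 : C) m%:C)).
    apply: open_comp; last exact: ball_open.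
    by move=> x _; exact: coord_continuous.
  by apply/seteqP; split => x; rewrite /= -ball_normE /= distrC normC_nc ltcR.
- by rewrite /= subrr nc0.
- by move=> x /=; rewrite !lt_min => /and3P[_ _ xe]; exact: he.
- move=> x /=; rewrite !lt_min => /and3P[xr _ _].
  apply: (@hol_analytic R g x (r - nc (x 0 0 - z0))); first by rewrite subr_gt0.
  have := @hol_affine R r (r - nc (x 0 0 - z0)) _ 1 (x 0 0 - z0) hr.
  have -> : (fun z => g (1 * z + (x 0 0 - z0) + z0)) = (fun z => g (z + x 0 0)).
    by apply/funext => z; rewrite mul1r -addrA subrK.
  apply=> z zr; rewrite mul1r; apply: le_lt_trans (ncD _ _) _.
  by rewrite -ltrBrDr.
- exists P => // x /=; rewrite !lt_min => /and3P[_ xd _]; exact: hP.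
Qed.

End Algebraic.

(** * Products of basis elements of the Clifford algebra *)

Section CliffordBasis.
Variables (R : comNzRingType) (p q : nat).
Local Notation A := (clifford R p q).
Local Notation index := {set 'I_(p + q)}.
Implicit Types (x y : A) (H K L M : index).

Lemma symdiffK H K : symdiff H (symdiff H K) = K.
Proof. by apply/setP => i; rewrite !in_symdiff addbA addbb. Qed.

Lemma cl_sign_sqr H K : cl_sign R H K * cl_sign R H K = 1.
Proof.
rewrite /cl_sign -big_split big1 // => i _; rewrite -big_split big1 // => j _.
exact: gen_signM.
Qed.

Lemma cl_coef_sum (I : finType) (X : I -> A) K :
  cl_coef (\sum_i X i) K = \sum_i cl_coef (X i) K.
Proof. exact: sum_ffunE. Qed.

Lemma cl_coefN x K : cl_coef (- x) K = - cl_coef x K.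
Proof. exact: ffunE. Qed.

(** Multiplication by a basis element permutes the coordinates up to signs. This is
    the reason why, on the plane of e_M, a component of a slice function
    involves only one component of each of the two parts of its stem
    function. *)
Lemma cl_coef_mul_basis M y K :
  cl_coef (cl_basis R M * y) K = cl_sign R M (symdiff M K) * cl_coef y (symdiff M K).
Proof.
rewrite [y in LHS]cl_coefE mulr_sumr cl_coef_sum (bigD1 (symdiff M K)) //=.
have E (L : index) : cl_basis R M * (cl_coef y L *: cl_basis R L) =
    (cl_coef y L * cl_sign R M L) *: cl_basis R (symdiff M L).
  by rewrite -scalerAr [_ * _ in LHS]cl_mul_basis scalerA.
rewrite big1 => [|L LK]; rewrite E cl_coefZ cl_coef_basis.
  by rewrite symdiffK eqxx mulr1 addr0 mulrC.
case: eqVneq => [KE|_]; last by rewrite mulr0.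
by case/eqP: LK; rewrite KE symdiffK.
Qed.

Lemma gen_sign_swap (i j : 'I_(p + q)) : i != j -> gen_sign R i j * gen_sign R j i = -1.
Proof.
move=> ij; rewrite /gen_sign; case: ltngtP => [||/val_inj/eqP].
- by rewrite mul1r.
- by rewrite mulr1.
- by rewrite (negPf ij).
Qed.

(** Remove one index i from M: e_i and e_M' anticommute up to the sign
    (-1)^|M'|, and e_i squares to 1 or -1. So reordering contributes one sign for
    each pair of indices, and the squares one sign for each negative index. *)
Lemma cl_signMM M : cl_sign R M M =
  (-1) ^+ ('C(#|M|, 2) + #|[set i in M | (p <= i)%N]|).
Proof.
have [n] := ubnP #|M|; elim: n M => // n IH M.
have [->|[i iM]] := set_0Vmem M.
  rewrite /cl_sign big_set0 cards0 => _.
  by rewrite [X in #|pred_of_set X|](_ : _ = finset.set0) ?cards0 //; apply/setP => j; rewrite !inE.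
rewrite (cardsD1 i) iM add1n ltnS => Mn.
set M' := M :\ i in Mn *.
have ME : M = symdiff [set i]%SET M'.
  apply/setP => j; rewrite in_symdiff !inE; case: eqVneq => [->|] //=.
have iM' : i \notin M' by rewrite !inE eqxx.
have S1 : cl_sign R [set i]%SET [set i]%SET = (-1) ^+ (p <= i)%N.
  by rewrite /cl_sign !big_set1 /gen_sign ltnn [(p <= i)%N]leqNgt; case: ltnP.
have S2 : cl_sign R [set i]%SET M' * cl_sign R M' [set i]%SET = (-1) ^+ #|M'|.
  rewrite /cl_sign big_set1.
  have -> : \prod_(k in M') \prod_(j in [set i]%SET) gen_sign R k j =
      \prod_(k in M') gen_sign R k i by apply: eq_bigr => k _; rewrite big_set1.
  rewrite -big_split /= -prodr_const; apply: eq_bigr => j jM'.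
  by apply: gen_sign_swap; apply: contraNneq iM' => ->.
have -> : cl_sign R M M = (-1) ^+ (p <= i)%N * (-1) ^+ #|M'| * cl_sign R M' M'.
  by rewrite -S1 -S2 {1 2}ME cl_signDl !cl_signDr; ring.
rewrite IH //.
have -> : [set j in M | (p <= j)%N]%SET =
    (if (p <= i)%N then i |: [set j in M' | (p <= j)%N] else [set j in M' | (p <= j)%N])%SET.
  apply/setP => j; case: ifP => pi; rewrite !inE; case: eqVneq => [->|] //=.
    by rewrite iM pi.
  by rewrite pi andbF.
have -> : #|if (p <= i)%N then i |: [set j in M' | (p <= j)%N]
      else [set j in M' | (p <= j)%N]|%SET = ((p <= i) + #|[set j in M' | (p <= j)%N]|)%N.
  by case: ifP => pi //; rewrite cardsU1 inE (negPf iM').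
have -> : #|M'|.+1 = (1 + #|M'|)%N by [].
by rewrite add1n binS bin1 !exprD; ring.
Qed.

(** These are the subsets M for which e_M is an imaginary unit: the size modulo 4
    decides the conjugation, and for these sizes the square is -1 exactly when
    the number of positive indices is even. *)
Definition good M : bool :=
  ~~ odd #|[set i in M | (i < p)%N]| && ((#|M| %% 4 == 1)%N || (#|M| %% 4 == 2)%N).

Lemma odd_bin2 m : odd 'C(m, 2) = (1 < m %% 4)%N.
Proof.
have [n] := ubnP m; elim: n m => // n IH [|[|[|[|m]]]] // mn.
have -> : 'C(m.+4, 2) = ('C(m, 2) + (2 * m + 3).*2)%N.
  by rewrite !binS !bin1 ?bin0; lia.
rewrite oddD odd_double addbF -[in RHS](addn4 m) modnDr IH //; lia.
Qed.

Lemma good_sqr M : good M -> cl_basis R M * cl_basis R M = - 1.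
Proof.
move=> /andP[pos M4].
rewrite [LHS]cl_mul_basis cl_signMM.
have -> : symdiff M M = finset.set0 by apply/setP => i; rewrite in_symdiff addbb inE.
rewrite cl_basis0 -signr_odd oddD odd_bin2.
have cM : #|M| = (#|[set i in M | (i < p)%N]| + #|[set i in M | (p <= i)%N]|)%N.
  rewrite -cardsUI [X in (_ + #|pred_of_set X|)%N](_ : _ = finset.set0) ?cards0 ?addn0.
    by congr #|pred_of_set _|; apply/setP => i; rewrite !inE -andb_orr ltnNge orNb andbT.
  by apply/setP => i; rewrite !inE ltnNge; case: (p <= i)%N; rewrite ?andbF.
have oM : odd #|M| = odd #|[set i in M | (p <= i)%N]|.
  by rewrite cM oddD (negPf pos).
rewrite -oM (divn_eq #|M| 4) oddD oddM andbF /= modnMDl modn_mod.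
by case/orP: M4 => /eqP ->; rewrite /= scaleN1r.
Qed.

Lemma good_conj M : good M -> cl_conj (cl_basis R M) = - cl_basis R M.
Proof.
move=> /andP[_ M4]; apply/ffunP => K; rewrite [LHS]ffunE.
have -> : (- cl_basis R M) K = - cl_coef (cl_basis R M) K by exact: ffunE.
rewrite cl_coef_basis; case: (eqVneq K M) => [->|_]; last by rewrite oppr0 if_same.
by case/orP: M4 => /eqP ->.
Qed.

End CliffordBasis.

(** * Correcting a subset at three indices *)

Section Cover.
Variables (p q : nat).
Local Notation index := {set 'I_(p + q)}.
Implicit Types (H K L M N : index).

Definition toggle (c : bool) (t : 'I_(p + q)) N : index :=
  (if c then t |: N else N)%SET.

Lemma in_toggle c t N i : i \in toggle c t N = (c && (i == t)) || (i \in N).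
Proof. by rewrite /toggle; case: c; rewrite ?inE. Qed.

Lemma card_toggle c t N : t \notin N -> #|toggle c t N| = (c + #|N|)%N.
Proof. by move=> tN; rewrite /toggle; case: c => //; rewrite cardsU1 tN. Qed.

Lemma card_toggle_pos c t N : t \notin N ->
  #|[set i in toggle c t N | (i < p)%N]%SET| =
    ((c && (t < p)) + #|[set i in N | (i < p)%N]%SET|)%N.
Proof.
move=> tN; rewrite -(@card_toggle _ t); last by rewrite inE (negPf tN).
congr #|pred_of_set _|; apply/setP => i; rewrite !(inE, in_toggle).
by case: eqVneq => [->|_]; rewrite ?(negPf tN) ?andbF ?andbT ?orbF.
Qed.

(** Here a and m count the positive indices and all the indices outside of three
    given ones, c0, c1, c2 tell which of the three are to be added, and b0, b1,
    b2 tell which of them are positive. If the three are positive, the parity of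
    the number of added indices is imposed, but m + k and m + k + 2 both remain
    available, and one of them is 1 or 2 modulo 4. If only the first is
    positive, c0 is imposed and the size can take three consecutive values. If
    none is positive and a is even, the size can take four consecutive values. *)
Lemma parity_choice (b0 b1 b2 : bool) (a m : nat) :
  b1 = b2 -> b0 || ~~ b1 && ~~ odd a ->
  exists c0 c1 c2 : bool,
    ~~ odd ((c0 && b0) + ((c1 && b1) + ((c2 && b2) + a))) &&
    (((c0 + (c1 + (c2 + m))) %% 4 == 1) || ((c0 + (c1 + (c2 + m))) %% 4 == 2))%N.
Proof.
have addm (u : nat) : ((u + m) %% 4 = (u + m %% 4) %% 4)%N by rewrite modnDmr.
move=> <- b; have : (m %% 4 < 4)%N by rewrite ltn_mod.
have E c0 c1 c2 : ((c0 + (c1 + (c2 + m))) %% 4 = (c0 + c1 + c2 + m %% 4) %% 4)%N.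
  by rewrite !addnA addm.
have O c0 c1 c2 : odd (c0 + (c1 + (c2 + a))) = odd (c0 + c1 + c2) (+) odd a.
  by rewrite !addnA oddD.
have F (P : bool -> bool -> bool -> bool) :
    [|| P true true true, P true true false, P true false true, P true false false,
        P false true true, P false true false, P false false true | P false false false] ->
    exists c0 c1 c2 : bool, P c0 c1 c2.
  by do 7 (case/orP; [by do 3 eexists; eassumption|]); by do 3 eexists; eassumption.
move=> m4; apply: F; rewrite !E !O.
by move: (m %% 4)%N m4 b => [|[|[|[|//]]]] _; case: (odd a); case: b0; case: b1.
Qed.

(** L is changed at three indices only, so it differs from M inside of them. *)
Lemma good_modification (t0 t1 t2 : 'I_(p + q)) L :
  t0 != t1 -> t0 != t2 -> t1 != t2 ->
  (t1 < p)%N = (t2 < p)%N -> (t0 < p)%N || (p == 0)%N ->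
  exists2 M, good M & symdiff M L \subset [set t0; t1; t2]%SET.
Proof.
move=> t01 t02 t12 b12 b0; set N := (L :\: [set t0; t1; t2])%SET.
have b : (t0 < p)%N || ~~ (t1 < p)%N && ~~ odd #|[set i in N | (i < p)%N]%SET|.
  case/orP: b0 => [->//|/eqP p0].
  have lt0 (i : 'I_(p + q)) : (i < p)%N = false by move: (nat_of_ord i) => k; rewrite p0.
  rewrite [X in #|pred_of_set X|](_ : _ = finset.set0).
    by rewrite cards0 !lt0.
  by apply/setP => i; rewrite !inE lt0 andbF.
have [c0 [c1 [c2 H]]] := parity_choice #|N| b12 b.
exists (toggle c0 t0 (toggle c1 t1 (toggle c2 t2 N))).
  have n0 : t0 \notin toggle c1 t1 (toggle c2 t2 N).
    by rewrite !in_toggle !inE (negPf t01) (negPf t02) eqxx !andbF.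
  have n1 : t1 \notin toggle c2 t2 N.
    by rewrite !in_toggle !inE (negPf t12) eqxx !orbT !andbF.
  have n2 : t2 \notin N by rewrite !inE eqxx !orbT.
  by rewrite /good !card_toggle_pos // !card_toggle.
apply/fintype.subsetP => i; rewrite in_symdiff !in_toggle !inE.
case: (i == t0) (i == t1) (i == t2) => [] [] []; rewrite ?andbF ?andbT ?orbT //=.
by rewrite addbb.
Qed.

Lemma exists_good : (2 <= p + q)%N -> exists M, good M.
Proof.
move=> n2; have n0 : (0 < p + q)%N by apply: ltn_trans n2.
pose o0 := Ordinal n0; pose o1 := Ordinal (n2 : (1 < p + q)%N).
have o01 : o0 != o1 by [].
(* {0, 1} for p >= 2, {1} for p = 1 and {0} for p = 0 *)
pose M : index := toggle (p != 1)%N o0 (toggle (0 < p)%N o1 finset.set0).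
exists M; rewrite /good /M.
have n0' : o0 \notin toggle (0 < p)%N o1 finset.set0 by rewrite in_toggle (negPf o01) inE andbF.
have n1' : o1 \notin (finset.set0 : index) by rewrite inE.
rewrite !card_toggle_pos // !card_toggle // cards0.
rewrite [X in #|pred_of_set X|](_ : _ = finset.set0) ?cards0; last first.
  by apply/setP => i; rewrite !inE.
by rewrite /o0 /o1 /=; case: p => [|[|[|p']]].
Qed.

(** The set T has at most three elements when n is at least 3, or 4 if p = 2,
    which makes 8 subsets; the bound is at least 8 from n = 3 on. In the
    remaining cases all the subsets are taken: 4 for n = 2 and 8 for n = 3, and
    these are exactly the values of the bound. *)
Lemma good_cover : (2 <= p + q)%N -> exists2 T : index,
  (6 * 2 ^ #|T| <= (p + q) ^ 3 + 5 * (p + q) + 6)%N &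
  forall L, exists2 M, good M & symdiff M L \subset T.
Proof.
(* the squares at the three indices j, j + 1, j + 2 have the signs +, +, + or -, -, -
   or, for p = 1 and for p = 2, +, -, - *)
move=> n2; pose j : nat := (p == 2)%N.
have [nj|nj] := leqP (3 + j) (p + q).
  have h0 : (j < p + q)%N by lia.
  have h1 : (j.+1 < p + q)%N by lia.
  have h2 : (j.+2 < p + q)%N by lia.
  exists [set Ordinal h0; Ordinal h1; Ordinal h2]%SET.
    have T3 : (#|[set Ordinal h0; Ordinal h1; Ordinal h2]%SET| <= 3)%N.
      apply: leq_trans (leq_card_setU _ _) _; rewrite cards1 addn1 ltnS.
      by apply: leq_trans (leq_card_setU _ _) _; rewrite !cards1.
    apply: (@leq_trans (6 * 2 ^ 3)); first by rewrite leq_pmul2l // leq_exp2l.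
    have n3 : (3 <= p + q)%N by lia.
    have := leq_exp2r 3 (p + q) (ltn0Sn 2); rewrite n3 => /idP.
    by move: ((p + q) ^ 3)%N => N; lia.
  move=> L; apply: good_modification.
  - by apply/eqP => /(congr1 val) /=; lia.
  - by apply/eqP => /(congr1 val) /=; lia.
  - by apply/eqP => /(congr1 val) /=; lia.
  - by rewrite /= /j; case: (p) => [|[|[|p']]].
  - by rewrite /= /j; case: (p) => [|[|[|p']]].
exists [set: 'I_(p + q)]%SET.
  rewrite cardsT card_ord.
  by have [->|->] : (p + q = 2 \/ p + q = 3)%N by lia.
by move=> L; have [M gM] := exists_good n2; exists M => //; exact: subsetT.
Qed.

End Cover.

(** * Imaginary units and splitting bases among the basis elements *)

Section Splitting.
Variables (R : realType) (p q : nat).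
Local Notation A := (clifford R p q).
Local Notation index := {set 'I_(p + q)}.
Implicit Types (x : A) (H K L M : index).

Lemma good_sphere M : good M -> sphere (cl_basis R M).
Proof. by move=> gM; split; [exact: good_conj | exact: good_sqr]. Qed.

Lemma good_sphereN M : good M -> sphere (- cl_basis R M).
Proof.
move=> gM; split; last by rewrite mulrNN; exact: good_sqr.
apply/ffunP => K; have /ffunP/(_ K) := good_conj R gM.
have N y : (- y : A) K = - cl_coef y K by exact: ffunE.
have conjE (y : A) : cl_conj y K = if (#|K| %% 4 == 0)%N || (#|K| %% 4 == 3)%N
    then cl_coef y K else - cl_coef y K by exact: ffunE.
rewrite !N !conjE cl_coefN.
by case: ifP => _ // e; congr (- _).
Qed.

(** The subsets that do not contain an index i0 of M form a transversal of the
    pairs {K, symdiff M K}; the empty set is given the index 0 because a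
    splitting basis starts with 1. *)
Lemma transversal_index (i0 : 'I_(p + q)) :
  exists rep : 'I_(uA p q).+1 -> index,
    [/\ rep ord0 = finset.set0, injective rep, forall k, i0 \notin rep k
      & forall K, i0 \notin K -> exists k, K = rep k].
Proof.
pose S := powerset [set~ i0]%SET.
have memS K : (K \in S) = (i0 \notin K).
  rewrite powersetE; apply/fintype.subsetP/idP => [sK|nK i iK].
    by apply/negP => /sK; rewrite !inE eqxx.
  by rewrite !inE; apply: contraNneq nK => <-.
have cS : #|S| = (uA p q).+1.
  rewrite card_powerset cardsC1 card_ord /uA prednK ?expn_gt0 //.
have s0 : finset.set0 \in S by rewrite memS inE.
pose g (k : 'I_(uA p q).+1) : index := enum_val (cast_ord (esym cS) k).
have gI : injective g by move=> k k' /enum_val_inj /cast_ord_inj.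
have gS k : g k \in S by exact: enum_valP.
have gsurj K : K \in S -> exists k, K = g k.
  move=> KS; exists (cast_ord cS (enum_rank_in s0 K)).
  by rewrite /g cast_ordK enum_rankK_in.
have [k0 k0E] := gsurj _ s0.
exists (fun k => g (tperm ord0 k0 k)); split.
- by rewrite tpermL.
- by move=> k k' /gI /perm_inj.
- by move=> k; rewrite -memS.
- by move=> K; rewrite -memS => /gsurj[k ->]; exists (tperm ord0 k0 k); rewrite tpermK.
Qed.

(** Left multiplication by e_M exchanges, up to a sign, the two basis elements of
    each pair {K, symdiff M K}; so one element of each pair gives a basis over
    the plane of e_M, with the coordinates over R as components. *)
Lemma good_splitting M : good M -> exists rep : 'I_(uA p q).+1 -> index,
  splitting_basis (cl_basis R M) (fun k => cl_basis R (rep k)) /\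
  forall x, x = \sum_k ((cl_coef x (rep k))%:A +
    (cl_sign R M (rep k) * cl_coef x (symdiff M (rep k))) *: cl_basis R M)
    * cl_basis R (rep k).
Proof.
move=> gM; have [i0 i0M] : exists i0, i0 \in M.
  have [M0|] := set_0Vmem M; last by case=> i; exists i.
  by move: gM; rewrite /good M0 cards0 andbF.
have [rep [rep0 repI repN repS]] := transversal_index i0.
exists rep.
have EB (a b : R) k : (a%:A + b *: cl_basis R M) * cl_basis R (rep k) =
    a *: cl_basis R (rep k) + (b * cl_sign R M (rep k)) *: cl_basis R (symdiff M (rep k)).
  rewrite mulrDl -!scalerAl mul1r; congr (_ + _).
  by rewrite [_ * _ in LHS]cl_mul_basis scalerA.
have sN k k' : (symdiff M (rep k) == rep k') = false.
  apply/eqP => E; have := repN k'; rewrite -E in_symdiff i0M.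
  by rewrite (negPf (repN k)).
have sI k k' : (symdiff M (rep k) == symdiff M (rep k')) = (k == k').
  apply/eqP/eqP => [E|-> //]; apply: repI.
  by rewrite -(symdiffK M (rep k)) E symdiffK.
have coefE (a b : 'I_(uA p q).+1 -> R) k0 :
    cl_coef (\sum_k ((a k)%:A + b k *: cl_basis R M) * cl_basis R (rep k)) (rep k0) = a k0
    /\ cl_coef (\sum_k ((a k)%:A + b k *: cl_basis R M) * cl_basis R (rep k))
        (symdiff M (rep k0)) = b k0 * cl_sign R M (rep k0).
  rewrite !cl_coef_sum; split; rewrite (bigD1 k0) //= big1 => [|k kk0].
  - rewrite EB cl_coefD !cl_coefZ !cl_coef_basis eqxx mulr1 eq_sym sN.
    by rewrite mulr0 !addr0.
  - rewrite EB cl_coefD !cl_coefZ !cl_coef_basis (inj_eq repI) eq_sym (negPf kk0).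
    by rewrite [rep k0 == _]eq_sym sN !mulr0 addr0.
  - rewrite EB cl_coefD !cl_coefZ !cl_coef_basis eqxx mulr1 sN.
    by rewrite mulr0 add0r addr0.
  - rewrite EB cl_coefD !cl_coefZ !cl_coef_basis sI sN eq_sym (negPf kk0).
    by rewrite !mulr0 addr0.
have expand x : x = \sum_k ((cl_coef x (rep k))%:A +
    (cl_sign R M (rep k) * cl_coef x (symdiff M (rep k))) *: cl_basis R M)
    * cl_basis R (rep k).
  apply/ffunP => K; rewrite -[LHS]/(cl_coef x K) -[RHS]/(cl_coef _ K).
  have [iK|/repS[k ->]] := boolP (i0 \in K).
    have [k kE] : exists k, symdiff M K = rep k.
      by apply: repS; rewrite in_symdiff i0M iK.
    rewrite -(symdiffK M K) kE (coefE (fun k => cl_coef x (rep k)) _ k).2.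
    by rewrite mulrAC cl_sign_sqr mul1r.
  by rewrite (coefE (fun k => cl_coef x (rep k)) _ k).1.
split=> //; split.
- by rewrite rep0 cl_basis0.
- move=> c cJ c0 k.
  (* the real coordinate of c k on the plane of e_M *)
  pose a k := xget 0 [set a | exists b, c k = a%:A + b *: cl_basis R M].
  have aP k' : exists b, c k' = (a k')%:A + b *: cl_basis R M.
    rewrite /a; case: xgetP => [y -> //|/(_ _) no].
    by have [a' [b' E]] := cJ k'; case: (no a'); exists b'.
  have [b bE] := choice aP.
  have S0 : \sum_k ((a k)%:A + b k *: cl_basis R M) * cl_basis R (rep k) = 0.
    by rewrite -[RHS]c0; apply: eq_bigr => k' _; rewrite bE.
  have coef0 K : cl_coef (0 : A) K = 0 by exact: ffunE.
  have [] := coefE a b k; rewrite S0 !coef0 => a0 b0.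
  have bk : b k = 0 by rewrite -[b k]mulr1 -(cl_sign_sqr R M (rep k)) mulrA -b0 mul0r.
  by rewrite bE -a0 bk !scale0r addr0.
- move=> x; exists (fun k => (cl_coef x (rep k))%:A +
    (cl_sign R M (rep k) * cl_coef x (symdiff M (rep k))) *: cl_basis R M) => //.
  by move=> k; do 2 eexists.
Qed.

End Splitting.

(** * Families of components that detect slice-Nash functions *)

Section Determining.
Variables (R : realType) (p q : nat).
Local Notation C := (R[i] : numFieldType).
Local Notation A := (clifford R p q).
Local Notation index := {set 'I_(p + q)}.
Implicit Types (D : set C) (J : A) (K L M T : index).

Lemma hol_le (r s : R) (f : C -> C) : s <= r -> hol r f -> hol s f.
Proof. by move=> sr [f' [M h]]; exists f', M => z zs; apply: h; exact: lt_le_trans zs sr. Qed.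

Lemma coords_plane (x y : R) J : coords (x%:A + y *: J) = x *: coords 1 + y *: coords J.
Proof. by apply/rowP => k; rewrite !mxE cl_coefD !cl_coefZ. Qed.

Lemma continuous_plane m (u1 u2 : 'rV[R]_m) (z : C) :
  {for z, continuous (fun w : C => Re w *: u1 + Im w *: u2)}.
Proof.
have cid : {for z, continuous (fun w : C => w)} by exact: continuous_idC.
have cRe : Re w @[w --> z] --> Re z.
  exact: (@continuous_ReP R C z (fun w => w) cid).
have cIm : Im w @[w --> z] --> Im z.
  exact: (@continuous_ImP R C z (fun w => w) cid).
have c1 := @cvgZr_tmp R 'rV[R]_m C (nbhs z) _ _ _ u1 cRe.
have c2 := @cvgZr_tmp R 'rV[R]_m C (nbhs z) _ _ _ u2 cIm.
exact: (@cvgD R 'rV[R]_m C (nbhs z) _ _ _ _ _ (c1 _) (c2 _)).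
Qed.

(** On the plane of J the real Nash function g satisfies a polynomial relation in
    the two coordinates, obtained by restriction from the ambient space, and it
    is the real part of the holomorphic function h. *)
Lemma algebraic_of_real_nash D (g : A -> R) (h : C -> C) J (z0 : C) : open D -> D z0 ->
  sphere J -> real_nash_on (circular D) g ->
  (forall x y : R, D (x +i* y) -> g (x%:A + y *: J) = Re (h (x +i* y))) ->
  (exists2 r : R, 0 < r & hol r (fun z => h (z + z0))) ->
  forall kappa : R[i], kappa != 0 -> algebraic_near (fun z => kappa * h z) z0.
Proof.
case: z0 => x0 y0; set z0 : C := x0 +i* y0.
move=> oD Dz0 sJ gN gh [r1 r10 hol1] kappa k0.
have cX0 : circular D (x0%:A + y0 *: J) by exists x0, y0, J.
have [V [G [oV VX0 nG gG]]] := gN _ cX0.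
have [V1 [oV1 V1X0 V1V aG [P P0 GP]]] := nG _ VX0.
have [Q Q0 QG] := slice_polynomial (coords 1) (coords J) P0 oV1 aG GP.
have nV : nbhs z0 [set w : C | V1 (Re w *: coords 1 + Im w *: coords J)].
  apply: continuous_plane; rewrite -coords_plane; exact: open_nbhs_nbhs.
have nD : nbhs z0 D by exact: open_nbhs_nbhs.
have [d d0 hd] : exists2 d : R, 0 < d & forall w, nc (w - z0) < d ->
    D w /\ V1 (Re w *: coords 1 + Im w *: coords J).
  by apply/nbhsCP; exact: filterI nD nV.
pose r := Num.min r1 d / 2.
have r2 : r + r = Num.min r1 d by rewrite -splitr.
have r0 : 0 < r by rewrite divr_gt0 // lt_min r10.
have hol2 : hol (r + r) (fun z => h (z + z0)).
  by apply: hol_le hol1; rewrite r2 ge_min lexx.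
have rel (x y : R) : `|x| + `|y| < r + r ->
    mpoly.meval (pt3 (x0 + x) (y0 + y) (Re (h ((x +i* y) + z0)))) Q = 0.
  move=> xy; have wE : (x +i* y) + z0 = (x0 + x) +i* (y0 + y).
    by rewrite /z0; apply/eqP; rewrite eq_complex /= addrC eqxx addrC eqxx.
  have [] := hd ((x +i* y) + z0).
    rewrite addrK; apply: le_lt_trans (nc_le _) _; apply: lt_le_trans xy _.
    by rewrite r2 ge_min lexx orbT.
  rewrite wE => Dw V1w.
  have cw : circular D ((x0 + x)%:A + (y0 + y) *: J) by exists (x0 + x), (y0 + y), J.
  rewrite -(gh _ _ Dw) gG //; last by rewrite coords_plane; exact: V1V.
  by rewrite coords_plane; exact: QG.
have := algebraic_of_real_part r0 hol2 rel Q0 k0.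
suff -> : (fun z : C => kappa * h (z - (x0 +i* y0) + z0)) = (fun z => kappa * h z) by [].
by apply/funext => z; rewrite subrK.
Qed.

Section Components.
Variables (D : set C) (F : C -> A * A) (f : A -> A).
Hypotheses (oD : open D) (Ff : induces D F f) (hF : holomorphic_on D F).

(** The two K-components of F together are a holomorphic function in the ordinary
    sense when F satisfies the Cauchy-Riemann equations. *)
Definition component K (z : C) : C := cl_coef (F z).1 K +i* cl_coef (F z).2 K.

Lemma component_hol K (z0 : C) : D z0 ->
  exists2 r : R, 0 < r & hol r (fun z => component K (z + z0)).
Proof.
move=> Dz0; case: hF => C1 CR; have [C1a C1b] := C1 K.
apply: (C1_CR_hol oD Dz0 C1a C1b) => z Dz; have [] := CR z Dz.
move=> /ffunP/(_ K) + /ffunP/(_ K).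
rewrite !ffunE => /eqP + /eqP.
by rewrite subr_eq0 addr_eq0 => /eqP -> /eqP ->.
Qed.

(** With K = symdiff M L, the values of f_K on the planes of e_M and of - e_M are the
    real parts of phi_K - i s phi_L and of phi_K + i s phi_L, where phi stands for
    the components of F and s is a sign. Both functions are algebraic, and so
    is their difference, a multiple of phi_L. *)
Lemma component_algebraic L M (z0 : C) (kappa : R[i]) : D z0 -> good M ->
  real_nash_on (circular D) (fun x => cl_coef (f x) (symdiff M L)) ->
  kappa != 0 -> algebraic_near (fun z => kappa * component L z) z0.
Proof.
move=> Dz0 gM fN k0; set K := symdiff M L in fN.
pose s := cl_sign R M L.
have ss : s * s = 1 by exact: cl_sign_sqr.
have s0 : s != 0.
  by apply/eqP => sz; have /eqP := ss; rewrite sz mul0r eq_sym oner_eq0.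
pose h (sg : R) (z : C) : C := component K z + - ('i * (sg * s)%:C) * component L z.
have half (sg : R) (k : R[i]) : sphere (sg *: cl_basis R M : A) -> k != 0 ->
    algebraic_near (fun z => k * h sg z) z0.
  move=> sJ; apply: (algebraic_of_real_nash oD Dz0 sJ fN).
    move=> x y Dxy; rewrite Ff // cl_coefD -scalerAl cl_coefZ cl_coef_mul_basis symdiffK -/s.
    by rewrite /h /component /=; ring.
  have [rK rK0 hK] := component_hol K Dz0; have [rL rL0 hL] := component_hol L Dz0.
  exists (Num.min rK rL); first by rewrite lt_min rK0.
  apply: holD; first by apply: hol_le hK; rewrite ge_min lexx.
  apply: holM; first exact: hol_cst.
  by apply: hol_le hL; rewrite ge_min lexx orbT.
have sz : s%:C != 0 :> R[i] by rewrite (inj_eq (@complexI _)).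
have i0 : 'i != 0 :> R[i] by exact: neq0Ci.
have two0 : 2 != 0 :> R[i] by rewrite pnatr_eq0.
(* h (- 1) - h 1 is 2 i s times the component of index L *)
pose k : R[i] := kappa / (2 * 'i * s%:C).
have kE : k * (2 * 'i * s%:C) = kappa by rewrite /k divfK // !mulf_neq0.
have kn : k != 0 by apply: contraNneq k0 => kz; rewrite -kE kz mul0r.
have -> : (fun z : C => kappa * component L z) = (fun z => k * h (- 1) z - k * h 1 z).
  by apply/funext => z; rewrite -kE /h mulN1r mul1r rmorphN; ring.
apply: algebraic_near_sub.
  by apply: half => //; rewrite scaleN1r; exact: good_sphereN.
by apply: half => //; rewrite scale1r; exact: good_sphere.
Qed.

End Components.

(** Each component of F is reached from a component f_K with K inside of T through
    a good M. The components of F in the splitting basis of any good M are, up to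
    signs, these components. *)
Lemma nash_determining_powerset T : (2 <= p + q)%N ->
  (forall L, exists2 M, good M & symdiff M L \subset T) ->
  nash_determining R (powerset T).
Proof.
move=> n2 cover D f [_ oD _] [F [sF Ff hF]] fN; exists F; split=> //.
have nash L (e : R[i]) : e != 0 -> complex_nash_on D (fun z => e * component F L z).
  move=> e0; apply: complex_nash_local => // z0 Dz0; split.
    have [r r0 hr] := component_hol oD hF L Dz0; exists r => //.
    by apply: holM; first exact: hol_cst.
  have [M gM MT] := cover L.
  apply: (component_algebraic oD Ff hF Dz0 gM) => //.
  by apply: fN; rewrite powersetE.
have [M gM] := exists_good n2; have [rep [split_rep expand]] := good_splitting R gM.
pose G (s l : bool) k (z : C) : R := let y := if s then (F z).2 else (F z).1 in
  if l then cl_sign R M (rep k) * cl_coef y (symdiff M (rep k)) else cl_coef y (rep k).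
exists (cl_basis R M), (fun k => cl_basis R (rep k)), G; split=> //.
  exact: good_sphere.
move=> [] k; rewrite /G.
  have -> : (fun z : C => (cl_sign R M (rep k) * cl_coef (F z).1 (symdiff M (rep k)))
      +i* (cl_sign R M (rep k) * cl_coef (F z).2 (symdiff M (rep k)))) =
      (fun z => (cl_sign R M (rep k))%:C * component F (symdiff M (rep k)) z).
    by apply/funext => z; apply/eqP; rewrite eq_complex /=; apply/andP; split; apply/eqP; ring.
  apply: nash; rewrite (inj_eq (@complexI _)); apply/eqP => sz.
  by have /eqP := cl_sign_sqr R M (rep k); rewrite sz mul0r eq_sym oner_eq0.
have -> : (fun z : C => cl_coef (F z).1 (rep k) +i* cl_coef (F z).2 (rep k)) =
    (fun z => 1 * component F (rep k) z) by apply/funext => z; rewrite mul1r.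
by apply: nash; exact: oner_neq0.
Qed.

End Determining.

Theorem theorem1p12 (R : realType) (p q : nat) (n_ge2 : (2 <= p + q)%N) :
  exists2 l : nat, is_nash_number R p q l &
    (l%:R : rat) <= ((p + q)%:R ^+ 3 + 5 * (p + q)%:R + 6) / 6.
Proof.
have [T cT cover] := good_cover n_ge2.
have det := @nash_determining_powerset R _ _ _ n_ge2 cover.
pose card_det l := `[< exists2 KK : {set {set 'I_(p + q)}}, #|KK| = l & nash_determining R KK >].
have ex_det : exists l, card_det l by exists #|powerset T|; apply/asboolP; exists (powerset T).
case: (ex_minnP ex_det) => l /asboolP[KK cKK dKK] minl; exists l.
  split; first by exists KK.
  by move=> KK' dKK'; apply: minl; apply/asboolP; exists KK'.
have lT : (l <= 2 ^ #|T|)%N.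
  by rewrite -card_powerset; apply: minl; apply/asboolP; exists (powerset T).
rewrite ler_pdivlMr // -natrX -!natrM -!natrD ler_nat mulnC.
by apply: leq_trans cT; rewrite leq_pmul2l.
Qed.
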